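(* Let $H,\mathcal{H}$ be complex polynomials in two variables with $\mathcal{H}=\sigma\circ H\circ\psi^{-1}$ for some $\psi\in\mathrm{Aut}(\mathbb{C}^2)$, $\sigma\in\mathrm{Aut}(\mathbb{C})$, and let $\omega,\vartheta$ be polynomial 1-forms on $\mathbb{C}^2$ with $\vartheta=\sigma'\psi_*(\omega)$, where $\sigma'\in\mathbb{C}^*$ is the derivative of the affine map $\sigma$. 1) The corresponding infinitesimally perturbed Hamiltonian differential equations are algebraically equivalent, that is, $\sigma'\psi_*(dH+\varepsilon\omega)=d\mathcal{H}+\varepsilon\vartheta$. 2) Let $I(c)=\int_{\gamma(c)}\omega$ be the Abelian integral defined by $H$, $\omega$ and a cycle $\gamma(c_0)$ in a generic fiber of $H$, and let $\mathcal{I}(\mathfrak{c})=\int_{\delta(\mathfrak{c})}\vartheta$ with $\delta(\mathfrak{c})=\psi(\gamma(\sigma^{-1}(\mathfrak{c})))$, near $\mathfrak{c}_0=\sigma(c_0)$. Then $I(c)$ and $\mathcal{I}(\mathfrak{c})$ are algebraically equivalent, that is, $I(c)=\frac{1}{\sigma'}\,\mathcal{I}(\sigma(c))$, even if they are multivalued functions. 3) The cardinalities of the zeros (counted with multiplicities) of $I(c)$ in $\mathbb{C}\setminus\mathfrak{B}(H)$ and of $\mathcal{I}(\mathfrak{c})$ in $\mathbb{C}\setminus\mathfrak{B}(\mathcal{H})$ coincide. In particular, if $H$ has trivial global monodromy, then $$Z(I_i(c))=Z(\mathcal{I}_i(\mathfrak{c}))\quad\text{and}\quad\mathscr{N}_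{BC(H)}(\omega)=\mathscr{N}_{BC(\mathcal{H})}(\vartheta).$$
   Context: $\mathrm{Aut}(\mathbb{C}^2)$, $\mathrm{Aut}(\mathbb{C})$ are the groups of polynomial automorphisms; $\psi_*=(\psi^{-1})^*$ on forms. For $H\in\mathbb{C}[u,v]$, $\mathfrak{B}(H)\subset\mathbb{C}$ is the bifurcation set: the smallest finite set such that $H:\mathbb{C}^2\setminus H^{-1}(\mathfrak{B}(H))\to\mathbb{C}\setminus\mathfrak{B}(H)$ is a locally trivial smooth fibration; $c\notin\mathfrak{B}(H)$ is generic and $L_c=\{H=c\}$ is a generic fiber. A cycle $\gamma(c_0)$ is a non-contractible closed loop in $L_{c_0}$; $\gamma(c)$ is its continuous transport to nearby fibers, and $I(c)=\int_{\gamma(c)}\omega$ is a holomorphic germ at $c_0$ (which in general continues to a multivalued function on $\mathbb{C}\setminus\mathfrak{B}(H)$). $H$ is primitive if its generic fibers are connected. $H$ has trivial global monodromy if every loop in $\mathbb{C}\setminus\mathfrak{B}(H)$ based at $c_0$ induces the identity on $H_1(L_{c_0},\mathbb{Z})$. For the ''in particular'' part, $H$ is a primitive polynomial with trivial global monodromy and $BC(H)=\{\gamma_i(c)\mid 1\le i\le\mathfrak{r},\ c\in\mathbb{C}\setminus\mathfrak{B}(H)\}$, $\mathfrak{r}=\dim H_1(L_c,\mathbb{Z})$, denotes the canonical global generators of the fundamental groups of all the generic fibers, defined as follows. By the Neumann–Norbury classification there are polynomial automorphisms taking $H$ to a polynomial $\mathcal{K}(x,y)$ in one of the families $\mathfrak{F}_1=\{x^{q_1}\mathcal{S}^q+x^{p_1}\mathcal{S}^p\prod_{i=1}^{r-1}(\beta_i-x^{q_1}\mathcal{S}^q)^{a_i},\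 r\ge2\}$, $\mathfrak{F}_2=\{x^{p_1}\mathcal{S}^p\prod_{i=1}^{r-1}(\beta_i-x^{q_1}\mathcal{S}^q)^{a_i},\ r\ge1\}$, $\mathfrak{F}_3=\{y\prod_{i=1}^{r-1}(\beta_i-x)^{a_i}+h(x),\ r\ge1\}$ ($a_i$ positive integers, $\beta_i\in\mathbb{C}^*$ distinct, $\deg h<\sum a_i$, $0\le p_1<p$, $0\le q_1<q$, $pq_1-qp_1=\pm1$, $\mathcal{S}=x^ky+P(x)$, $k\ge1$, $\deg P\le k-1$), and the birational map $(\mathcal{G},\mathcal{K})$, with $\mathcal{G}=x^{q_1}\mathcal{S}^q$ for $\mathfrak{F}_1,\mathfrak{F}_2$ and $\mathcal{G}=x$ for $\mathfrak{F}_3$, maps each generic fiber of $\mathcal{K}$ biholomorphically onto a horizontal line punctured at $\mathfrak{r}$ finite points; the $i$-th generator of a generic fiber is the preimage of a simple loop enclosing anticlockwise exactly the $i$-th finite puncture. $BC(\mathcal{H})$ is the corresponding set for $\mathcal{H}$, with generators $\delta_i(\mathfrak{c})=\psi(\gamma_i(\sigma^{-1}(\mathfrak{c})))$. Put $I_i(c)=\int_{\gamma_i(c)}\omega$, $\mathcal{I}_i(\mathfrak{c})=\int_{\delta_i(\mathfrak{c})}\vartheta$; $Z(\cdot)$ is the number of zeros, counted with multiplicities, outside the bifurcation set. $\mathscr{N}_{BC(H)}(\omega)$ (for $\omega$ non-conservative for $BC(H)$, i.e. no $I_i$ identically zero) is the number of complex limit cycles of $dH+\varepsilon\omega=0$ generated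 from complex cycles in $BC(H)$: a complex cycle is a free homotopy class of non-contractible loops in a leaf of the foliation, a complex limit cycle is a complex cycle with first return map different from the identity, and $\gamma(c_0)$ generates a complex limit cycle if there is a continuous family of complex limit cycles of $dH+\varepsilon\omega=0$, $\varepsilon\ne0$ small, tending to $\gamma(c_0)$ as $\varepsilon\to0$. Similarly for $\mathscr{N}_{BC(\mathcal{H})}(\vartheta)$. *)

(* Defs.v *)
From HB Require Import structures.
From mathcomp Require Import all_boot all_order all_algebra.
From mathcomp Require Import all_classical all_reals all_analysis.
From mathcomp Require Import complex.
Import numFieldNormedType.Exports.

Set Implicit Arguments.
Unset Strict Implicit.
Unset Printing Implicit Defensive.
Import Order.TTheory GRing.Theory Num.Theory.
Local Open Scope ring_scope.
Local Open Scope complex_scope.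
Local Open Scope classical_set_scope.

(* R[i] as a numClosedFieldType: it is this structure that carries the topology
   and the normed C-module structure. *)
Definition Cplx (R : realType) : numClosedFieldType := R[i].

Notation poly2 R := {poly {poly Cplx R}}.

Section Definitions.
Variable R : realType.

Local Notation C := (Cplx R).
Local Notation C2 := (C * C)%type.
Local Notation I01 := (`[0%R, 1%R]%classic : set R).

(* In {poly {poly C}} the inner variable is the first coordinate u (resp. x) and
   the outer variable is the second coordinate v (resp. y). *)
Definition ev (p : poly2 R) (z : C2) : C := p.[z.2%:P].[z.1].

Definition pmap (f : poly2 R * poly2 R) (z : C2) : C2 := (ev f.1 z, ev f.2 z).

(* A 1-form eta is the function (z, v) |-> eta_z(v), for v tangent at z. *)
Definition form := C2 -> C2 -> C.

(* (A, B) stands for A du + B dv. *)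
Definition pform := (poly2 R * poly2 R)%type.

Definition form_of (w : pform) : form :=
  fun z v => ev w.1 z * v.1 + ev w.2 z * v.2.

Definition dform (p : poly2 R) : pform := (map_poly (@deriv C) p, deriv p).

Definition dmap (f : poly2 R * poly2 R) (z v : C2) : C2 :=
  (form_of (dform f.1) z v, form_of (dform f.2) z v).

Definition pull_form (f : poly2 R * poly2 R) (eta : form) : form :=
  fun z v => eta (pmap f z) (dmap f z v).

Record aut2 := Aut2 {
  aut2_poly : poly2 R * poly2 R;
  aut2_ipoly : poly2 R * poly2 R;
  aut2_polyK : cancel (pmap aut2_poly) (pmap aut2_ipoly);
  aut2_ipolyK : cancel (pmap aut2_ipoly) (pmap aut2_poly) }.

Definition aut2_fun (f : aut2) : C2 -> C2 := pmap (aut2_poly f).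

Definition aut2_inv (f : aut2) : aut2 :=
  Aut2 (@aut2_ipolyK f) (@aut2_polyK f).

Definition push_form (f : aut2) (eta : form) : form :=
  pull_form (aut2_poly (aut2_inv f)) eta.

Record aut1 := Aut1 {
  aut1_poly : {poly C};
  aut1_ipoly : {poly C};
  aut1_polyK : cancel (horner aut1_poly) (horner aut1_ipoly);
  aut1_ipolyK : cancel (horner aut1_ipoly) (horner aut1_poly) }.

Definition aut1_fun (s : aut1) : C -> C := horner (aut1_poly s).

Definition aut1_inv (s : aut1) : aut1 :=
  Aut1 (@aut1_ipolyK s) (@aut1_polyK s).

(* Polynomial automorphisms of C are affine, so that the derivative is constant
   and the point of evaluation is immaterial. *)
Definition aut1_deriv (s : aut1) : C := (deriv (aut1_poly s)).[0].

(* f is of class C^k on the open subset U. *)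
Fixpoint Ck (V W : normedModType R) (k : nat) (U : set V) (f : V -> W) : Prop :=
  match k with
  | 0%N => forall x, U x -> {for x, continuous f}
  | k'.+1 => (forall x, U x -> differentiable f x) /\
             forall v, Ck k' U (fun x => 'd f x v)
  end.

(* Smoothness on an arbitrary subset: local extension to C^infty maps. *)
Definition smooth_on (V W : normedModType R) (A : set V) (f : V -> W) : Prop :=
  forall x, A x -> exists (U : set V) (g : V -> W),
    [/\ open U, U x, forall k, Ck k U g & forall y, U y -> A y -> g y = f y].

Definition R2_of_C (z : C) : R * R := (complex.Re z, complex.Im z).
Definition C_of_R2 (a : R * R) : C := (a.1 +i* a.2)%C.
Definition R4_of_C2 (z : C2) : (R * R) * (R * R) := (R2_of_C z.1, R2_of_C z.2).
Definition C2_of_R4 (a : (R * R) * (R * R)) : C2 := (C_of_R2 a.1, C_of_R2 a.2).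

Definition fiber (H : poly2 R) (c : C) : set C2 := [set z | ev H z = c].

(* H is a locally trivial smooth fibration over the complement of B.  Near c the
   model fiber is the fiber over c itself: z |-> (H z, phi z) is a
   diffeomorphism from H^-1(U) onto U x H^-1(c), and Phi is its inverse. *)
Definition locally_trivial (H : poly2 R) (B : set C) : Prop :=
  forall c, ~ B c -> exists (U : set C) (phi : C2 -> C2) (Phi : C * C2 -> C2),
    [/\ [/\ open U, U c & U `<=` ~` B],
        forall z, U (ev H z) -> fiber H c (phi z) /\ Phi (ev H z, phi z) = z,
        forall b w, U b -> fiber H c w ->
          ev H (Phi (b, w)) = b /\ phi (Phi (b, w)) = w,
        smooth_on [set a | U (ev H (C2_of_R4 a))]
          (fun a => R4_of_C2 (phi (C2_of_R4 a))) &
        smooth_on [set a : (R * R) * ((R * R) * (R * R)) |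
                    U (C_of_R2 a.1) /\ fiber H c (C2_of_R4 a.2)]
          (fun a => R4_of_C2 (Phi (C_of_R2 a.1, C2_of_R4 a.2)))].

Definition bifset (H : poly2 R) : set C :=
  smallest (fun B => finite_set B /\ locally_trivial H B) set0.

(* Paths and loops are functions on R of which only the restriction to [0, 1]
   is relevant; homotopies are likewise considered on the unit square. *)
Definition is_loop (T : topologicalType) (A : set T) (g : R -> T) : Prop :=
  [/\ {within I01, continuous g}, g 0 = g 1 & forall t, I01 t -> A (g t)].

Definition loop_homotopic (T : topologicalType) (A : set T) (g g' : R -> T) :=
  exists h : R * R -> T,
    [/\ {within I01 `*` I01, continuous h},
        forall s t, I01 s -> I01 t -> A (h (s, t)),
        forall s, I01 s -> h (s, 0) = h (s, 1) &
        forall t, I01 t -> h (0, t) = g t /\ h (1, t) = g' t].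

Definition contractible (T : topologicalType) (A : set T) (g : R -> T) : Prop :=
  exists z : T, loop_homotopic A g (fun=> z).

Definition piecewise_C1 (g : R -> C2) : Prop :=
  exists (n : nat) (s : nat -> R),
    [/\ s 0%N = 0, s n = 1 &
      forall i, (i < n)%N -> s i < s i.+1 /\
        exists2 f : R -> C2, Ck 1 setT (R4_of_C2 \o f) &
          forall t, s i <= t <= s i.+1 -> g t = f t].

Definition smooth_loop (A : set C2) (g : R -> C2) : Prop :=
  is_loop A g /\ piecewise_C1 g.

Definition is_cycle (H : poly2 R) (c : C) (g : R -> C2) : Prop :=
  smooth_loop (fiber H c) g /\ ~ contractible (fiber H c) g.

(* gam c is the continuous transport of the loop gam c0 to the fibers near c0. *)
Definition transported (H : poly2 R) (c0 : C) (gam : C -> R -> C2) : Prop :=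
  exists N : set C,
    [/\ nbhs c0 N, N `<=` ~` bifset H,
        {within N `*` I01, continuous (fun a : C * R => gam a.1 a.2)} &
        forall c, N c -> smooth_loop (fiber H c) (gam c)].

Definition velocity (g : R -> C2) (t : R) : C2 :=
  ((((fun s => complex.Re (g s).1)^`() t) +i* ((fun s => complex.Im (g s).1)^`() t))%C,
   (((fun s => complex.Re (g s).2)^`() t) +i* ((fun s => complex.Im (g s).2)^`() t))%C).

(* The velocity has no meaning at the finitely many break points of a piecewise
   C^1 loop, which are negligible. *)
Definition line_integral (w : pform) (g : R -> C2) : C :=
  let f t : C := form_of w (g t) (velocity g t) in
  ((\int[lebesgue_measure]_(t in I01) complex.Re (f t)) +i*
   (\int[lebesgue_measure]_(t in I01) complex.Im (f t)))%C.

Definition abelian_integral (w : pform) (gam : C -> R -> C2) : C -> C :=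
  fun c => line_integral w (gam c).

Definition holomorphic_at (V W : normedModType C) (f : V -> W) (z : V) : Prop :=
  \forall y \near z, differentiable f y.

Definition germ (f : C -> C) (c : C) : set (C -> C) :=
  [set g | \forall z \near c, g z = f z].

(* F t is a holomorphic germ at lam t, and F is an analytic continuation of
   F 0 along the path lam in the complement of B. *)
Definition continuation (B : set C) (lam : R -> C) (F : R -> C -> C) : Prop :=
  [/\ {within I01, continuous lam},
      forall t, I01 t -> ~ B (lam t),
      forall t, I01 t -> holomorphic_at (F t) (lam t) &
      forall t, I01 t ->
        \forall s \near t, I01 s -> germ (F t) (lam s) (F s)].

(* g represents, at c, a branch of the multivalued function obtained by
   continuing the germ of f at c0 in the complement of B. *)
Definition is_branch (B : set C) (f : C -> C) (c0 c : C) (g : C -> C) : Prop :=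
  exists (lam : R -> C) (F : R -> C -> C),
    [/\ continuation B lam F, lam 0 = c0, lam 1 = c,
        germ f c0 (F 0) & germ g c (F 1)].

(* f vanishes at c with multiplicity at least k. *)
Definition vanishes (f : C -> C) (c : C) (k : nat) : Prop :=
  exists2 g : C -> C, holomorphic_at g c &
    \forall z \near c, f z = (z - c) ^+ k * g z.

(* The zeros counted with multiplicities of a function, resp. of all the branches
   of a multivalued function, as a set: a zero of multiplicity m contributes m
   elements, labelled by k = 0, ..., m - 1 (and a germ vanishing identically has
   infinite multiplicity).  A branch at c is recorded by its germ. *)
Definition zeros (B : set C) (f : C -> C) : set (C * nat) :=
  [set x | ~ B x.1 /\ vanishes f x.1 x.2.+1].

Definition branch_zeros (B : set C) (f : C -> C) (c0 : C) :
    set (C * set (C -> C) * nat) :=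
  [set x | exists g, [/\ is_branch B f c0 x.1.1 g, x.1.2 = germ g x.1.1 &
                         vanishes g x.1.1 x.2.+1]].

(* A singular 1-chain is a formal sum of 1-simplices with domain [0, 1]; coef x s
   is the coefficient of the simplex s in x. *)
Definition chain1 := seq (int * (R -> C2)).

Definition coef (x : chain1) (s : R -> C2) : int :=
  \sum_(p <- x | `[< forall t, I01 t -> p.2 t = s t >]) p.1.

Definition cycle1 (A : set C2) (x : chain1) : Prop :=
  (forall p, p \in x ->
     {within I01, continuous p.2} /\ forall t, I01 t -> A (p.2 t)) /\
  forall z : C2, \sum_(p <- x) p.1 * ((p.2 1 == z)%:Z - (p.2 0 == z)%:Z) = 0.

Definition simplex2 : set (R * R) :=
  [set a | [/\ 0 <= a.1, 0 <= a.2 & a.1 + a.2 <= 1]].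

Definition boundary2 (d : seq (int * (R * R -> C2))) : chain1 :=
  flatten [seq [:: (p.1, fun t => p.2 (1 - t, t));
                   (- p.1, fun t => p.2 (0, t));
                   (p.1, fun t => p.2 (t, 0))] | p <- d].

Definition homologous (A : set C2) (x y : chain1) : Prop :=
  exists d : seq (int * (R * R -> C2)),
    (forall p, p \in d ->
       {within simplex2, continuous p.2} /\ forall a, simplex2 a -> A (p.2 a)) /\
    forall s, coef x s - coef y s = coef (boundary2 d) s.

Definition chain_map (f : C2 -> C2) (x : chain1) : chain1 :=
  [seq (p.1, f \o p.2) | p <- x].

Definition chain_scale (n : int) (x : chain1) : chain1 :=
  [seq (n * p.1, p.2) | p <- x].

(* H_1(A, Z) is a free abelian group of rank r. *)
Definition H1_rank (A : set C2) (r : nat) : Prop :=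
  exists z : 'I_r -> chain1, (forall i, cycle1 A (z i)) /\
    forall x, cycle1 A x -> exists! n : {ffun 'I_r -> int},
      homologous A x (\big[cat/[::]]_(i < r) chain_scale (n i) (z i)).

Definition primitive (H : poly2 R) : Prop :=
  forall c, ~ bifset H c -> connected (fiber H c).

(* h t is a homeomorphism from the fiber over lam 0 to the fiber over lam t, and
   both h t and its inverse k t depend continuously on t. *)
Definition parallel_transport (H : poly2 R) (lam : R -> C) (h : R -> C2 -> C2) :=
  exists k : R -> C2 -> C2,
    [/\ forall t, I01 t -> set_bij (fiber H (lam 0)) (fiber H (lam t)) (h t),
        forall t z, I01 t -> fiber H (lam 0) z -> k t (h t z) = z,
        {within I01 `*` fiber H (lam 0),
           continuous (fun a : R * C2 => h a.1 a.2)},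
        {within [set a : R * C2 | I01 a.1 /\ fiber H (lam a.1) a.2],
           continuous (fun a : R * C2 => k a.1 a.2)} &
        forall z, fiber H (lam 0) z -> h 0 z = z].

Definition trivial_monodromy (H : poly2 R) : Prop :=
  forall (c0 : C) (lam : R -> C) (h : R -> C2 -> C2),
    is_loop (~` bifset H) lam -> lam 0 = c0 -> parallel_transport H lam h ->
    forall x, cycle1 (fiber H c0) x ->
      homologous (fiber H c0) (chain_map (h 1) x) x.

Local Notation x_ := ('X%:P : poly2 R).
Local Notation y_ := ('X : poly2 R).
Local Notation cst c := (c%:P%:P : poly2 R).

Definition nn_exponents (p p1 q q1 : nat) : Prop :=
  [/\ (p1 < p)%N, (q1 < q)%N &
      (p * q1 = q * p1 + 1)%N \/ (q * p1 = p * q1 + 1)%N].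

Definition nn_roots (n : nat) (b : 'I_n -> C) (a : 'I_n -> nat) : Prop :=
  [/\ injective b, forall i, b i != 0 & forall i, (0 < a i)%N].

(* S = x^k y + P(x); deg P <= k - 1 reads size P <= k. *)
Definition nn_S (k : nat) (P : {poly C}) : poly2 R := x_ ^+ k * y_ + P%:P.

(* In each case, K is the normal form and G the first component of the
   associated birational map (G, K). *)
Definition nn_family1 (K G : poly2 R) : Prop :=
  exists (r p p1 q q1 k : nat) (P : {poly C})
         (b : 'I_r.-1 -> C) (a : 'I_r.-1 -> nat),
    let S := nn_S k P in
    [/\ [/\ (2 <= r)%N, (1 <= k)%N & (size P <= k)%N],
        nn_exponents p p1 q q1, nn_roots b a, G = x_ ^+ q1 * S ^+ q &
        K = G + x_ ^+ p1 * S ^+ p * \prod_i (cst (b i) - G) ^+ a i].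

Definition nn_family2 (K G : poly2 R) : Prop :=
  exists (r p p1 q q1 k : nat) (P : {poly C})
         (b : 'I_r.-1 -> C) (a : 'I_r.-1 -> nat),
    let S := nn_S k P in
    [/\ [/\ (1 <= r)%N, (1 <= k)%N & (size P <= k)%N],
        nn_exponents p p1 q q1, nn_roots b a, G = x_ ^+ q1 * S ^+ q &
        K = x_ ^+ p1 * S ^+ p * \prod_i (cst (b i) - G) ^+ a i].

(* deg h < sum_i a_i reads size h <= sum_i a_i. *)
Definition nn_family3 (K G : poly2 R) : Prop :=
  exists (r : nat) (h : {poly C}) (b : 'I_r.-1 -> C) (a : 'I_r.-1 -> nat),
    [/\ (1 <= r)%N, nn_roots b a, (size h <= \sum_i a i)%N, G = x_ &
        K = y_ * \prod_i (cst (b i) - x_) ^+ a i + h%:P].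

Definition nn_normal_form (K G : poly2 R) : Prop :=
  [\/ nn_family1 K G, nn_family2 K G | nn_family3 K G].

(* (G, K) maps each generic fiber K = k bijectively (hence, being holomorphic and
   injective, biholomorphically) onto the line C x {k} punctured at
   rho 1 k, ..., rho r k; the labelling of the punctures depends continuously
   on k. *)
Definition punctures (K G : poly2 R) (r : nat) (rho : 'I_r -> C -> C) : Prop :=
  (forall i, {within ~` bifset K, continuous (rho i)}) /\
  forall k, ~ bifset K k ->
    injective (fun i => rho i k) /\
    set_bij (fiber K k) [set s | forall i, s <> rho i k] (ev G).

(* The loop g avoids a and has winding number n around a. *)
Definition winding (g : R -> C) (a : C) (n : int) : Prop :=
  exists theta : R -> R,
    [/\ {within I01, continuous theta},
        forall t, I01 t -> g t <> a /\
          g t - a = `|g t - a| * (cos (theta t) +i* sin (theta t))%C &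
        theta 1 - theta 0 = 2 * pi * n%:~R].

(* g is a simple loop enclosing anticlockwise rho i and no other rho j. *)
Definition encloses_only (r : nat) (rho : 'I_r -> C) (i : 'I_r) (g : R -> C) :=
  [/\ is_loop [set s | forall j, s <> rho j] g,
      forall s t, 0 <= s < 1 -> 0 <= t < 1 -> g s = g t -> s = t &
      forall j, winding g (rho j) (j == i)%:Z].

(* gam i c is the i-th canonical generator of the generic fiber H = c: the
   polynomial automorphisms f and s take H to the normal form K, and gam i c is
   the preimage under G \o f of a simple loop around the i-th puncture. *)
Definition canonical_generators (H : poly2 R) (r : nat)
    (gam : 'I_r -> C -> R -> C2) : Prop :=
  exists (K G : poly2 R) (f : aut2) (s : aut1) (rho : 'I_r -> C -> C),
    [/\ nn_normal_form K G,
        forall z, ev K z = aut1_fun s (ev H (aut2_fun (aut2_inv f) z)),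
        punctures K G rho,
        forall c, ~ bifset H c -> H1_rank (fiber H c) r &
        forall i c, ~ bifset H c ->
          smooth_loop (fiber H c) (gam i c) /\
          encloses_only (fun j => rho j (aut1_fun s c)) i
            (fun t => ev G (aut2_fun f (gam i c t)))].

Definition non_conservative (H : poly2 R) (w : pform) (r : nat)
    (gam : 'I_r -> C -> R -> C2) : Prop :=
  forall i, exists2 c, ~ bifset H c & abelian_integral w (gam i) c != 0.

Definition perturbed (H : poly2 R) (w : pform) (e : C) : form :=
  fun z v => form_of (dform H) z v + e * form_of w z v.

(* F is, near p, a holomorphic first integral without critical points of the
   foliation Om = 0, which is nonsingular at p. *)
Definition first_integral (Om : form) (p : C2) (F : C2 -> C) : Prop :=
  (exists v, Om p v != 0) /\
  \forall z \near p, differentiable F z /\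
    exists2 g : C, g != 0 & forall v, 'd F z v = g * Om z v.

(* f maps D continuously into the leaves (for the leaf topology): near each point
   f stays in a plaque, i.e. in a level set of a local first integral. *)
Definition leafwise (Om : form) (T : topologicalType) (D : set T) (f : T -> C2) :=
  {within D, continuous f} /\
  forall x, D x -> exists2 F, first_integral Om (f x) F &
    \forall y \near x, D y -> F (f y) = F (f x).

Definition leaf_loop (Om : form) (g : R -> C2) : Prop :=
  leafwise Om I01 g /\ g 0 = g 1.

Definition leaf_homotopic (Om : form) (g g' : R -> C2) : Prop :=
  exists h : R * R -> C2,
    [/\ leafwise Om (I01 `*` I01) h,
        forall s, I01 s -> h (s, 0) = h (s, 1) &
        forall t, I01 t -> h (0, t) = g t /\ h (1, t) = g' t].

(* A loop representing a complex cycle (a free homotopy class). *)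
Definition complex_cycle (Om : form) (g : R -> C2) : Prop :=
  leaf_loop Om g /\ ~ exists z, leaf_homotopic Om g (fun=> z).

(* P is (the germ at 0 of) the first return map along the loop g, in the
   coordinate z on the transversal z |-> tau z through g 0 = tau 0: the paths
   lift z, close to g = lift 0, go in the leaves from tau z to tau (P z). *)
Definition return_map (Om : form) (g : R -> C2) (tau : C -> C2) (P : C -> C) :=
  [/\ [/\ holomorphic_at tau 0, tau 0 = g 0 & Om (tau 0) ('d tau 0 1) != 0],
      {for 0, continuous P}, P 0 = 0 &
      exists (N : set C) (lift : C -> R -> C2),
        [/\ nbhs 0 N, {within N `*` I01, continuous (fun a : C * R => lift a.1 a.2)},
            forall t, I01 t -> lift 0 t = g t &
            forall z, N z ->
              [/\ leafwise Om I01 (lift z), lift z 0 = tau z &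
                  lift z 1 = tau (P z)]]].

Definition limit_cycle (Om : form) (g : R -> C2) : Prop :=
  complex_cycle Om g /\
  exists (tau : C -> C2) (P : C -> C),
    return_map Om g tau P /\ ~ (\forall z \near 0, P z = z).

(* Gam e, for e != 0 small, is a continuous family of complex limit cycles of
   dH + e w = 0 which tends, as e -> 0, to the complex cycle of g in H = c. *)
Definition generated_family (H : poly2 R) (w : pform) (c : C) (g : R -> C2)
    (Gam : C -> R -> C2) : Prop :=
  exists D : set C,
    [/\ nbhs 0 D, {within D `*` I01, continuous (fun a : C * R => Gam a.1 a.2)},
        loop_homotopic (fiber H c) (Gam 0) g &
        forall e, D e -> e != 0 -> limit_cycle (perturbed H w e) (Gam e)].

(* The complex limit cycles generated from the cycles gam i c, c generic; two
   families define the same one if, for all small e != 0, they represent the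
   same complex cycle of dH + e w = 0. *)
Definition generated_limit_cycles (H : poly2 R) (w : pform) (r : nat)
    (gam : 'I_r -> C -> R -> C2) : set (set (C -> R -> C2)) :=
  [set X | exists (i : 'I_r) (c : C) (Gam : C -> R -> C2),
     [/\ ~ bifset H c, generated_family H w c (gam i c) Gam &
         X = [set Gam' | \forall e \near 0^',
                leaf_homotopic (perturbed H w e) (Gam' e) (Gam e)]]].

End Definitions.

(* Main.v *)
(* The map psi sends the fiber H = c biregularly onto H' = sigma c and multiplies
   the pencil dH + e omega by sigma', so it transports everything in sight: local
   trivializations (hence the bifurcation sets), loops and their homotopies,
   homology classes, leaves and return maps.  The integrals of omega and theta
   over corresponding cycles differ by the constant sigma', and sigma is affine;
   zeros, multiplicities and analytic continuations therefore correspond under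
   c |-> sigma c.  The hypotheses are symmetric under psi, sigma |-> psi^-1,
   sigma^-1, so that each transport is proved in one direction only. *)
Require Import Defs.
From HB Require Import structures.
From mathcomp Require Import all_boot all_order all_algebra.
From mathcomp Require Import all_classical all_reals all_analysis.
From mathcomp Require Import complex ring.
Set Implicit Arguments.
Unset Strict Implicit.
Unset Printing Implicit Defensive.

Import numFieldNormedType.Exports.
Import Order.TTheory GRing.Theory Num.Theory.
Local Open Scope ring_scope.
Local Open Scope classical_set_scope.
Local Open Scope card_scope.
(* [seq] exports another [pmap]. *)
Local Notation pmap := Defs.pmap.

(** The bijections are short; the work lies in the stability of each notion under psi and sigma.
    Polynomial maps must be differentiated in several senses: over C for forms and leaves, along
    real curves for velocities, and in R^4 to every order for trivializations. Each sense obeys the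
    sum and product rules, so one induction on polynomials serves them all. Conjugated
    trivializations also need C^k to be stable under composition, although [Ck] speaks of
    directional derivatives only. Loops are merely piecewise C^1, so integrands are compared off the
    break points; the complex factor sigma' mixes real and imaginary parts, and integrability is
    what allows them to be separated. For multivalued integrals a relation near c0 suffices: h |->
    sigma' h o sigma^-1 carries a continuation along lambda to one along sigma o lambda. A zero of a
    branch is recorded with its germ, a set of functions, so the bijection has to act on such sets
    as well. *)

Section Evaluation.
Variable R : realType.
Local Notation C := (Cplx R).
Local Notation C2 := (C * C)%type.
Implicit Types (p q : poly2 R) (z v : C2) (f : poly2 R * poly2 R).

Lemma evC (c : {poly C}) z : ev c%:P z = c.[z.1].
Proof. by rewrite /ev hornerC. Qed.

Lemma evD p q z : ev (p + q) z = ev p z + ev q z.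
Proof. by rewrite /ev !hornerD. Qed.

Lemma evM p q z : ev (p * q) z = ev p z * ev q z.
Proof. by rewrite /ev !hornerM. Qed.

Lemma evX z : ev 'X z = z.2.
Proof. by rewrite /ev hornerX hornerC. Qed.

(* All the differentiability statements about polynomials used below (complex
   and real differentials, velocities, classes C^k) are instances of this one. *)
Lemma ev_derivation (X : Type) (D : (X -> C) -> C -> Prop) (z : X -> C2)
    (x : X) (v : C2) :
  (forall c, D (fun=> c) 0) ->
  (forall g h l m, D g l -> D h m -> D (fun y => g y + h y) (l + m)) ->
  (forall g h l m, D g l -> D h m ->
     D (fun y => g y * h y) (g x * m + l * h x)) ->
  D (fun y => (z y).1) v.1 -> D (fun y => (z y).2) v.2 ->
  forall p, D (fun y => ev p (z y)) (form_of (dform p) (z x) v).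
Proof.
move=> Dc DD DM D1 D2.
have Dpoly (c : {poly C}) : D (fun y => c.[(z y).1]) (c^`().[(z x).1] * v.1).
  elim/poly_ind: c => [|c a IH].
    under [X in D X]eq_fun do rewrite horner0.
    by rewrite deriv0 horner0 mul0r; exact: Dc.
  under [X in D X]eq_fun do rewrite hornerMXaddC.
  rewrite derivD derivC addr0 derivM derivX mulr1 hornerD hornerM hornerX.
  have := DD _ _ _ _ (DM _ _ _ _ IH D1) (Dc a).
  by rewrite addr0 mulrDl addrC mulrAC.
elim/poly_ind => [|p c IH].
  under [X in D X]eq_fun do rewrite /ev horner0 horner0.
  rewrite /form_of /dform /= map_poly0 deriv0 /ev !horner0 !mul0r addr0.
  exact: Dc.
under [X in D X]eq_fun do rewrite evD evM evX evC.
have := DD _ _ _ _ (DM _ _ _ _ IH D2) (Dpoly c).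
congr D; rewrite /form_of /dform /=.
(* [deriv] is not multiplicative, so the coefficients are compared one by one, using only that
   [deriv] is additive and kills 0. *)
have -> : map_poly (@deriv C) (p * 'X + c%:P) =
    map_poly (@deriv C) p * 'X + (c^`())%:P.
  apply/polyP => i; rewrite coef_map_id0 ?deriv0// !coefD !coefMX !coefC.
  rewrite derivD !(fun_if (@deriv _)) deriv0 coef_map_id0 ?deriv0//.
rewrite derivD derivC addr0 derivM derivX mulr1 !evD !evM !evX evC.
by ring.
Qed.


(** Simultaneous substitution of [f.1] and [f.2] for the two variables; it makes composites of
    polynomial automorphisms polynomial again. *)
Definition ev_comp p f : poly2 R :=
  \sum_(i < size p) (\sum_(j < size p`_i) (p`_i`_j)%:P%:P * f.1 ^+ j) * f.2 ^+ i.

Lemma ev_compE p f z : ev (ev_comp p f) z = ev p (pmap f z).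
Proof.
have ev_sum n (F : 'I_n -> poly2 R) : ev (\sum_i F i) z = \sum_i ev (F i) z.
  elim/big_ind2: _ => [|_ q1 _ q2 <- <-|//]; last exact: evD.
  by rewrite /ev !horner0.
have evXn q n : ev (q ^+ n) z = ev q z ^+ n.
  by rewrite /ev !horner_exp.
rewrite ev_sum [in RHS]/ev (horner_coef p) horner_sum; apply: eq_bigr => i _.
rewrite evM evXn ev_sum hornerM horner_exp hornerC horner_coef.
by congr (_ * _); apply: eq_bigr => j _; rewrite evM evXn evC hornerC.
Qed.

End Evaluation.

(** * Composition of polynomial automorphisms; automorphisms of C are affine *)

Section Automorphisms.
Variable R : realType.
Local Notation C := (Cplx R).
Local Notation C2 := (C * C)%type.
Implicit Types (psi : aut2 R) (sigma : aut1 R).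

Definition pmap_comp (f g : poly2 R * poly2 R) := (ev_comp f.1 g, ev_comp f.2 g).

Lemma pmap_compE f g : pmap (pmap_comp f g) = pmap f \o pmap g.
Proof. by apply/funext => z; rewrite /pmap /= !ev_compE. Qed.

Lemma aut2_funK psi : cancel (aut2_fun psi) (aut2_fun (aut2_inv psi)).
Proof. exact: aut2_polyK. Qed.

Lemma aut2_invK psi : cancel (aut2_fun (aut2_inv psi)) (aut2_fun psi).
Proof. exact: aut2_ipolyK. Qed.

Lemma aut1_funK sigma : cancel (aut1_fun sigma) (aut1_fun (aut1_inv sigma)).
Proof. exact: aut1_polyK. Qed.

Lemma aut1_invK sigma : cancel (aut1_fun (aut1_inv sigma)) (aut1_fun sigma).
Proof. exact: aut1_ipolyK. Qed.

(** Serves to compose the automorphism normalizing H with psi^-1. The inverse is specified too,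
    because a normal form is related to H through it. *)
Lemma aut2_comp (f g : aut2 R) :
  exists h, aut2_fun h = aut2_fun f \o aut2_fun g /\
    aut2_fun (aut2_inv h) = aut2_fun (aut2_inv g) \o aut2_fun (aut2_inv f).
Proof.
have hK : cancel (pmap (pmap_comp (aut2_poly f) (aut2_poly g)))
                 (pmap (pmap_comp (aut2_ipoly g) (aut2_ipoly f))).
  by rewrite !pmap_compE; apply: can_comp; apply: aut2_polyK.
have hK' : cancel (pmap (pmap_comp (aut2_ipoly g) (aut2_ipoly f)))
                  (pmap (pmap_comp (aut2_poly f) (aut2_poly g))).
  by rewrite !pmap_compE; apply: can_comp; apply: aut2_ipolyK.
by exists (Aut2 hK hK'); rewrite /aut2_fun /= !pmap_compE.
Qed.

Lemma aut1_comp (s t : aut1 R) : exists u, aut1_fun u = aut1_fun s \o aut1_fun t.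
Proof.
have hK : cancel (horner (aut1_poly s \Po aut1_poly t))
                 (horner (aut1_ipoly t \Po aut1_ipoly s)).
  by move=> x; rewrite !horner_comp aut1_polyK aut1_polyK.
have hK' : cancel (horner (aut1_ipoly t \Po aut1_ipoly s))
                  (horner (aut1_poly s \Po aut1_poly t)).
  by move=> x; rewrite !horner_comp aut1_ipolyK aut1_ipolyK.
by exists (Aut1 hK hK'); apply/funext => x; rewrite /aut1_fun /= horner_comp.
Qed.

(** C is infinite. This turns the pointwise cancellation laws of [aut1] into polynomial identities,
    to which degrees apply. *)
Lemma horner_inj : injective (fun p : {poly C} => horner p).
Proof.
move=> p q pq; apply/eqP; rewrite -subr_eq0; apply/negPn/negP => pq0.
(* As many distinct natural numbers as [size (p - q)]: one root more than the degree allows. *)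
pose rs : seq C := [seq i%:R | i <- iota 0 (size (p - q))].
have rs_root : all (root (p - q)) rs.
  apply/allP => x _; rewrite /root hornerD hornerN.
  by rewrite (congr1 (@^~ x) pq) subrr.
have rs_uniq : uniq rs.
  by rewrite map_inj_uniq ?iota_uniq//; exact: (mulrIn (oner_neq0 _)).
by have := max_poly_roots pq0 rs_root rs_uniq; rewrite size_map size_iota ltnn.
Qed.

(** Degrees multiply under composition, and the composite with the inverse is 'X, of degree 1. *)
Lemma size_aut1_poly sigma : size (aut1_poly sigma) = 2.
Proof.
have : aut1_ipoly sigma \Po aut1_poly sigma = 'X.
  apply: horner_inj; apply/funext => x.
  by rewrite horner_comp hornerX aut1_polyK.
move=> /(congr1 (fun p : {poly C} => (size p).-1)).
rewrite size_comp_poly size_polyX => /eqP; rewrite muln_eq1 => /andP[_].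
by case: (size _) => [|[|[|]]].
Qed.

Lemma aut1_affine sigma c :
  aut1_fun sigma c = aut1_deriv sigma * c + aut1_fun sigma 0.
Proof.
rewrite /aut1_fun /aut1_deriv.
have -> : aut1_poly sigma =
    ((aut1_poly sigma)`_1)%:P * 'X + ((aut1_poly sigma)`_0)%:P.
  apply/polyP => -[|[|i]]; rewrite coefD coefMX !coefC ?addr0 ?add0r//=.
  by rewrite nth_default ?size_aut1_poly.
rewrite derivD derivM !derivC derivX mul0r add0r mulr1 addr0.
by rewrite !hornerD !hornerM !hornerC !hornerX mulr0 add0r.
Qed.

(** The product is the slope of sigma^-1 o sigma = id, read off from its values at 0 and 1. *)
Lemma aut1_derivM sigma : aut1_deriv (aut1_inv sigma) * aut1_deriv sigma = 1.
Proof.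
have tE := aut1_affine (aut1_inv sigma).
have := aut1_funK sigma 0; rewrite tE => h0.
have := aut1_funK sigma 1; rewrite tE (aut1_affine _ 1) mulr1 mulrDr -addrA h0.
by rewrite addr0.
Qed.

Lemma aut1_deriv_neq0 sigma : aut1_deriv sigma != 0.
Proof.
apply/eqP => s0; have := aut1_derivM sigma; rewrite s0 mulr0.
by move/esym/eqP; rewrite oner_eq0.
Qed.

Lemma aut1_deriv_inv sigma : aut1_deriv (aut1_inv sigma) = (aut1_deriv sigma)^-1.
Proof. by rewrite -[LHS](mulfK (aut1_deriv_neq0 sigma)) aut1_derivM mul1r. Qed.

End Automorphisms.

(** * Differentials of projections, sums, products and affine maps *)

Section Differential.

Lemma fst_continuous (K : numDomainType) (V W : normedModType K) : continuous (@fst V W).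
Proof. by move=> x; exact: cvg_fst. Qed.

Lemma snd_continuous (K : numDomainType) (V W : normedModType K) : continuous (@snd V W).
Proof. by move=> x; exact: cvg_snd. Qed.

Lemma is_diff_fst (K : numFieldType) (V W : normedModType K) (z : V * W) :
  is_diff z (@fst V W) (@fst V W).
Proof.
apply: DiffDef; first by apply: linear_differentiable; exact: fst_continuous.
by rewrite diff_lin//; exact: fst_continuous.
Qed.

Lemma is_diff_snd (K : numFieldType) (V W : normedModType K) (z : V * W) :
  is_diff z (@snd V W) (@snd V W).
Proof.
apply: DiffDef; first by apply: linear_differentiable; exact: snd_continuous.
by rewrite diff_lin//; exact: snd_continuous.
Qed.

Lemma diffM_val (K : numFieldType) (V : normedModType K) (f g : V -> K) x v :
  differentiable f x -> differentiable g x ->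
  differentiable (fun y => f y * g y) x /\
  'd (fun y => f y * g y) x v = f x * 'd g x v + 'd f x v * g x.
Proof.
move=> df dg; split; first exact: differentiableM.
have E := congr1 (@^~ v) (diffM df dg).
exact: etrans E (congr1 (+%R _) (mulrC (g x) _)).
Qed.

Lemma diffD_val (K : numFieldType) (V W : normedModType K) (f g : V -> W) x v :
  differentiable f x -> differentiable g x ->
  differentiable (fun y => f y + g y) x /\
  'd (fun y => f y + g y) x v = 'd f x v + 'd g x v.
Proof.
by move=> df dg; split; [exact: differentiableD|rewrite (diffD df dg)].
Qed.

Lemma is_diff_affine (K : numFieldType) (a b x : K) :
  is_diff x (fun c => a * c + b) ( *%R a).
Proof.
have did : differentiable (@id K) x by exact: ex_diff.
have dM v := diffM_val v (differentiable_cst a x) did.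
have dA v := diffD_val v (dM v).1 (differentiable_cst b x).
apply: DiffDef; first exact: (dA 0).1.
apply/funext => v; rewrite (dA v).2 (dM v).2 !diff_cst diff_val.
by rewrite mul0r !addr0.
Qed.

End Differential.

(** * Complex differentials of polynomial maps, and the pencil's exact part dH *)

Section ComplexDifferential.
Variable R : realType.
Local Notation C := (Cplx R).
Local Notation C2 := (C * C)%type.
Implicit Types (p : poly2 R) (z v : C2) (f g : poly2 R * poly2 R).

Lemma is_diff_ev p z : is_diff z (ev p) (form_of (dform p) z).
Proof.
(* With the tangent vector fixed, the derivative is a number, as [ev_derivation] requires. *)
pose D v (f : C2 -> C) (l : C) := differentiable f z /\ 'd f z v = l.
have DP v : D v (ev p) (form_of (dform p) z v).
  apply: (@ev_derivation R C2 (D v) id z v).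
  - by move=> c; split; [exact: differentiable_cst|rewrite diff_cst].
  - by move=> f g l m [df <-] [dg <-]; exact: diffD_val.
  - by move=> f g l m [df <-] [dg <-]; exact: diffM_val.
  - by have := is_diff_fst z => ?; split; rewrite ?diff_val.
  - by have := is_diff_snd z => ?; split; rewrite ?diff_val.
apply: DiffDef; first exact: (DP 0).1.
by apply/funext => v; exact: (DP v).2.
Qed.

Lemma is_diff_pmap f z : is_diff z (pmap f) (dmap f z).
Proof.
have := is_diff_ev f.1 z; have := is_diff_ev f.2 z => d1 d2.
exact: is_diff_pair.
Qed.

Lemma pmap_continuous f : continuous (pmap f).
Proof.
move=> z; have ? := is_diff_pmap f z.
by apply: differentiable_continuous; exact: ex_diff.
Qed.

(** Chain rule for g o f = id and uniqueness of the differential. *)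
Lemma dmapK f g z v : cancel (pmap f) (pmap g) ->
  dmap g (pmap f z) (dmap f z v) = v.
Proof.
move=> fK; have d := is_diff_comp (is_diff_pmap f z) (is_diff_pmap g (pmap f z)).
have e : pmap g \o pmap f = id by apply/funext => x; exact: fK.
rewrite e in d; exact: etrans (congr1 (@^~ v) (esym (@diff_val _ _ _ _ _ _ _ d)))
  (congr1 (@^~ v) (@diff_val _ _ _ _ _ _ _ (is_diff_id z))).
Qed.

(** Chain rule for H' = sigma o H o psi^-1; sigma is first put in affine form, so its differential
    is multiplication by a constant. *)
Lemma form_of_dform_aut H H' (psi : aut2 R) (sigma : aut1 R) z v :
  (forall y, ev H' y = aut1_fun sigma (ev H (aut2_fun (aut2_inv psi) y))) ->
  form_of (dform H') z v =
  aut1_deriv sigma * push_form psi (form_of (dform H)) z v.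
Proof.
move=> hH; pose g := aut2_ipoly psi; pose a := aut1_deriv sigma.
have d1 := is_diff_pmap g z; have d2 := is_diff_ev H (pmap g z).
have d3 := is_diff_affine a (aut1_fun sigma 0) (ev H (pmap g z)).
have d4 := is_diff_ev H' z.
have e : ev H' = (fun c => a * c + aut1_fun sigma 0) \o (ev H \o pmap g).
  by apply/funext => y; rewrite hH aut1_affine.
have d5 := is_diff_comp (is_diff_comp d1 d2) d3; rewrite -e in d5.
exact: etrans (congr1 (@^~ v) (esym (@diff_val _ _ _ _ _ _ _ d4)))
  (congr1 (@^~ v) (@diff_val _ _ _ _ _ _ _ d5)).
Qed.

End ComplexDifferential.

(** * Calculus of C^k maps between real normed modules *)

Section DifferentiabilityClasses.
Variable R : realType.
Implicit Types (V W : normedModType R).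

Lemma near_eq_differentiable (K : numFieldType) (V W : normedModType K)
    (f g : V -> W) x :
  {near x, f =1 g} -> differentiable f x ->
  differentiable g x /\ forall v, 'd g x v = 'd f x v.
Proof.
move=> fg df; have fgx : f x = g x := nbhs_singleton fg.
have dfc := diff_continuous df.
have fgs : \forall h \near (0 : V), f (h + x) = g (h + x).
  suff : (fun h : V => h + x) @ (0 : V) --> x by move=> H; exact: (H _ fg).
  by rewrite -[X in _ --> X]add0r; apply: cvgD; [exact: cvg_id|exact: cvg_cst].
(* The first-order expansion of f is also one of g; uniqueness identifies the two differentials, and
   the expansion then yields differentiability of g. *)
have E : g \o shift x = cst (g x) + 'd f x +o_ 0 id.
  have /eqaddoP fo := diff_locally df.
  apply/eqaddoP => e e0; move: (fo _ e0); apply: filterS2 fgs => h fgh.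
  by rewrite /= /GRing.add /= /GRing.opp /= -fgh -fgx.
have dE := diff_unique dfc E.
split=> [|v]; last exact: (congr1 (fun h : V -> W => h v) dE).
by apply/diff_locallyP; split; rewrite dE.
Qed.

Lemma open_near_eq V W (U : set V) (f g : V -> W) x : open U -> U x ->
  (forall y, U y -> f y = g y) -> {near x, f =1 g}.
Proof. by move=> oU Ux fg; apply: filterS fg _; exact: open_nbhs_nbhs. Qed.

Lemma Ck_continuous V W k (U : set V) (f : V -> W) :
  Ck k U f -> forall x, U x -> {for x, continuous f}.
Proof.
case: k => [//|k] [df _] x Ux; apply: differentiable_continuous; exact: df.
Qed.

Lemma CkW V W k (U : set V) (f : V -> W) : Ck k.+1 U f -> Ck k U f.
Proof.
elim: k f => [|k IH] f Cf; first exact: (Ck_continuous Cf).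
by case: Cf => df Cdf; split=> // v; apply: IH; exact: Cdf.
Qed.

Lemma Ck_subset V W k (U U' : set V) (f : V -> W) :
  U' `<=` U -> Ck k U f -> Ck k U' f.
Proof.
move=> UU; elim: k f => [|k IH] f /=; first by move=> Cf x /UU; exact: Cf.
by case=> df Cdf; split=> [x /UU|v]; [exact: df|apply: IH; exact: Cdf].
Qed.

(** On an open set equality holds near each point, hence passes to the differentials. This is how
    computed derivatives are substituted in all the closure lemmas below. *)
Lemma eq_Ck V W k (U : set V) (f g : V -> W) : open U ->
  (forall x, U x -> f x = g x) -> Ck k U f -> Ck k U g.
Proof.
move=> oU; elim: k f g => [|k IH] f g fg.
  move=> Cf x Ux; rewrite /prop_for /continuous_at -fg//.
  apply: cvg_trans (Cf x Ux); apply: near_eq_cvg.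
  exact: open_near_eq oU Ux fg.
move=> [df Cf]; have D x (Ux : U x) :=
  near_eq_differentiable (open_near_eq oU Ux fg) (df x Ux).
split=> [x Ux|v]; first exact: (D x Ux).1.
apply: IH (Cf v) => x Ux; exact: esym ((D x Ux).2 v).
Qed.

Lemma Ck_cst V W k (U : set V) (a : W) : Ck k U (cst a).
Proof.
elim: k a => [|k IH] a; first by move=> x _; exact: cst_continuous.
split=> [x _|v]; first exact: differentiable_cst.
rewrite (_ : (fun x => _) = cst 0); first exact: IH.
by apply/funext => x; rewrite diff_cst.
Qed.

Lemma CkD V W k (U : set V) (f g : V -> W) : open U ->
  Ck k U f -> Ck k U g -> Ck k U (fun x => f x + g x).
Proof.
move=> oU; elim: k f g => [|k IH] f g.
  by move=> Cf Cg x Ux; apply: continuousD; [exact: Cf|exact: Cg].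
move=> [df Cf] [dg Cg].
have D x v (Ux : U x) := diffD_val v (df _ Ux) (dg _ Ux).
split=> [x Ux|v]; first by have [] := D x 0 Ux.
apply: (eq_Ck oU _ (IH _ _ (Cf v) (Cg v))) => x Ux; exact: esym (D x v Ux).2.
Qed.

Lemma CkM V k (U : set V) (f g : V -> R) : open U ->
  Ck k U f -> Ck k U g -> Ck k U (fun x => f x * g x).
Proof.
move=> oU; elim: k f g => [|k IH] f g.
  by move=> Cf Cg x Ux; apply: continuousM; [exact: Cf|exact: Cg].
move=> Cf1 Cg1; have [df Cf] := Cf1; have [dg Cg] := Cg1.
have D x v (Ux : U x) := diffM_val v (df _ Ux) (dg _ Ux).
split=> [x Ux|v]; first by have [] := D x 0 Ux.
apply: (eq_Ck oU _ (CkD oU (IH _ _ (CkW Cf1) (Cg v)) (IH _ _ (Cf v) (CkW Cg1)))).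
move=> x Ux; exact: esym (D x v Ux).2.
Qed.

Lemma Ck_linear V W W' k (U : set V) (L : {linear W -> W'}) (f : V -> W) :
  open U -> continuous L -> Ck k U f -> Ck k U (L \o f).
Proof.
move=> oU cL; elim: k f => [|k IH] f.
  by move=> Cf x Ux; apply: continuous_comp; [exact: Cf|exact: cL].
move=> [df Cf]; have dL y : differentiable L y by exact: linear_differentiable.
split=> [x Ux|v]; first by apply: differentiable_comp; [exact: df|].
apply: (eq_Ck oU _ (IH _ (Cf v))) => x Ux.
have E := diff_comp (df x Ux) (dL (f x)); rewrite (diff_lin _ cL) in E.
exact: esym (congr1 (fun h : V -> W' => h v) E).
Qed.

Lemma Ck_id V k (U : set V) : Ck k U (@id V).
Proof.
case: k => [|k]; first by move=> x _; exact: cvg_id.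
split=> [x _|v]; first exact: ex_diff.
rewrite (_ : (fun x => _) = cst v); first exact: Ck_cst.
by apply/funext => x; rewrite diff_val.
Qed.

Lemma Ck_fst V W W' k (U : set V) (f : V -> W * W') :
  open U -> Ck k U f -> Ck k U (fun x => (f x).1).
Proof. by move=> oU; apply: Ck_linear => //; exact: fst_continuous. Qed.

Lemma Ck_snd V W W' k (U : set V) (f : V -> W * W') :
  open U -> Ck k U f -> Ck k U (fun x => (f x).2).
Proof. by move=> oU; apply: Ck_linear => //; exact: snd_continuous. Qed.

Lemma Ck_pair V W W' k (U : set V) (f : V -> W) (g : V -> W') : open U ->
  Ck k U f -> Ck k U g -> Ck k U (fun x => (f x, g x)).
Proof.
move=> oU; elim: k f g => [|k IH] f g.
  by move=> Cf Cg x Ux; apply: cvg_pair; [exact: Cf|exact: Cg].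
move=> [df Cf] [dg Cg]; split=> [x Ux|v].
  by apply: differentiable_pair; [exact: df|exact: dg].
apply: (eq_Ck oU _ (IH _ _ (Cf v) (Cg v))) => x Ux.
exact: esym (congr1 (fun h : V -> W * W' => h v) (diff_pair (df x Ux) (dg x Ux))).
Qed.

(* Stands in for finite dimensionality: [Ck] speaks of directional derivatives
   only, so that the chain rule needs [x |-> T x (w x)] to be C^k as soon as all
   the [x |-> T x v] are. *)
Definition Ck_evaluable V := forall W k (U : set W) (T : W -> {linear V -> R})
  (w : W -> V), open U -> (forall v, Ck k U (T^~ v)) -> Ck k U w ->
  Ck k U (fun x => T x (w x)).

(** By linearity [T x (w x)] is the product of [w x] and [T x 1]. *)
Lemma Ck_evaluable_R : Ck_evaluable R.
Proof.
move=> W k U T w oU CT Cw; apply: (eq_Ck oU _ (CkM oU Cw (CT 1))) => x _.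
by rewrite -[in RHS](mulr1 (w x)) [RHS]linearZ.
Qed.

(** Split T x (a, b) = T x (a, 0) + T x (0, b); each summand is a linear form on one factor. *)
Lemma Ck_evaluable_prod V W :
  Ck_evaluable V -> Ck_evaluable W -> Ck_evaluable (V * W)%type.
Proof.
move=> eV eW X k U T w oU CT Cw.
have lin1 x : linear (fun v : V => T x (v, 0)).
  move=> a u v; rewrite -linearPZ; congr (T x _).
  by congr pair; rewrite /= scaler0 addr0.
have lin2 x : linear (fun v : W => T x (0, v)).
  move=> a u v; rewrite -linearPZ; congr (T x _).
  by congr pair; rewrite /= scaler0 addr0.
pose T1 x : {linear V -> R} :=
  HB.pack (fun v : V => T x (v, 0)) (GRing.isLinear.Build _ _ _ _ _ (lin1 x)).
pose T2 x : {linear W -> R} :=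
  HB.pack (fun v : W => T x (0, v)) (GRing.isLinear.Build _ _ _ _ _ (lin2 x)).
have C1 := eV _ _ _ T1 _ oU (fun v => CT (v, 0)) (Ck_fst oU Cw).
have C2 := eW _ _ _ T2 _ oU (fun v => CT (0, v)) (Ck_snd oU Cw).
apply: (eq_Ck oU _ (CkD oU C1 C2)) => x _ /=.
rewrite -linearD; congr (T x _); case: (w x) => a b.
by congr pair; rewrite /= ?addr0 ?add0r.
Qed.

Lemma Ck_comp V W k (U : set V) (U' : set W) (f : V -> W) (g : W -> R) :
  Ck_evaluable W -> open U -> (forall x, U x -> U' (f x)) ->
  Ck k U f -> Ck k U' g -> Ck k U (g \o f).
Proof.
move=> eW oU UU; elim: k g => [|k IH] g.
  move=> Cf Cg x Ux; apply: continuous_comp; first exact: Cf.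
  by apply: Cg; exact: UU.
move=> Cf1 [dg Cg]; have [df Cf] := Cf1; split=> [x Ux|v].
  by apply: differentiable_comp; [exact: df|apply: dg; exact: UU].
have E x (Ux : U x) := diff_comp (df x Ux) (dg _ (UU x Ux)).
apply: (@eq_Ck _ _ _ _ (fun x => 'd g (f x) ('d f x v)) _ oU).
  move=> x Ux; exact: esym (congr1 (fun h : V -> R => h v) (E x Ux)).
(* In the chain rule both the linear form and its argument vary with x. Evaluability reduces this to
   a fixed argument u, where the induction hypothesis applies to y |-> 'd g y u. *)
apply: (eW _ _ _ (fun x => 'd g (f x)) _ oU) => [u|]; last exact: Cf.
by apply: (IH (fun y => 'd g y u)); [exact: CkW|exact: Cg].
Qed.

End DifferentiabilityClasses.

(** * Smoothness of polynomial maps in real coordinates *)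

Section RealCoordinates.
Variable R : realType.
Local Notation C := (Cplx R).
Local Notation C2 := (C * C)%type.
Local Notation R4 := ((R * R) * (R * R))%type.
Implicit Types (V W : normedModType R) (p : poly2 R) (g : poly2 R * poly2 R).

Lemma cReM (x y : C) : complex.Re (x * y) =
  complex.Re x * complex.Re y - complex.Im x * complex.Im y.
Proof. by case: x y => [a b] [c d]. Qed.

Lemma cImM (x y : C) : complex.Im (x * y) =
  complex.Re x * complex.Im y + complex.Im x * complex.Re y.
Proof. by case: x y => [a b] [c d]. Qed.

Lemma cReD (x y : C) : complex.Re (x + y) = complex.Re x + complex.Re y.
Proof. by case: x y => [a b] [c d]. Qed.

Lemma cImD (x y : C) : complex.Im (x + y) = complex.Im x + complex.Im y.
Proof. by case: x y => [a b] [c d]. Qed.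

Lemma R2_of_CK : cancel (@R2_of_C R) (@C_of_R2 R).
Proof. by case. Qed.

Lemma C2_of_R4K : cancel (@C2_of_R4 R) (@R4_of_C2 R).
Proof. by case=> [[a b] [c d]]. Qed.

Lemma R4_of_C2K : cancel (@R4_of_C2 R) (@C2_of_R4 R).
Proof. by case=> [[a b] [c d]]. Qed.

Lemma Ck_R4_of_C2 V k (U : set V) (f : V -> C2) : open U ->
  Ck k U (@R4_of_C2 R \o f) <->
  (Ck k U (fun x => complex.Re (f x).1) /\ Ck k U (fun x => complex.Im (f x).1)) /\
  (Ck k U (fun x => complex.Re (f x).2) /\ Ck k U (fun x => complex.Im (f x).2)).
Proof.
move=> oU; split=> [Cf|[[C11 C12] [C21 C22]]].
  have C1 := Ck_fst oU Cf; have C2 := Ck_snd oU Cf.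
  split; split; [exact: Ck_fst oU C1|exact: Ck_snd oU C1|..];
    [exact: Ck_fst oU C2|exact: Ck_snd oU C2].
by apply: Ck_pair => //; apply: Ck_pair.
Qed.

Lemma Ck_ev V k (U : set V) p (f : V -> C2) : open U ->
  Ck k U (@R4_of_C2 R \o f) ->
  Ck k U (fun x => complex.Re (ev p (f x))) /\
  Ck k U (fun x => complex.Im (ev p (f x))).
Proof.
move=> oU /(Ck_R4_of_C2 _ _ oU)[C1 C2].
pose D (h : V -> C) (l : C) :=
  Ck k U (fun x => complex.Re (h x)) /\ Ck k U (fun x => complex.Im (h x)).
(* This [D] ignores the value of the derivative, so the point and the tangent vector are dummies. *)
apply: (@ev_derivation R V D f 0 0) => //.
- by move=> c; split; exact: Ck_cst.
- move=> h1 h2 l m [h11 h12] [h21 h22]; split.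
    by apply: (eq_Ck oU _ (CkD oU h11 h21)) => x _; rewrite cReD.
  by apply: (eq_Ck oU _ (CkD oU h12 h22)) => x _; rewrite cImD.
- move=> h1 h2 l m [h11 h12] [h21 h22]; split.
    have CN := CkM oU (Ck_cst k U (-1 : R)) (CkM oU h12 h22).
    by apply: (eq_Ck oU _ (CkD oU (CkM oU h11 h21) CN)) => x _; rewrite cReM mulN1r.
  by apply: (eq_Ck oU _ (CkD oU (CkM oU h11 h22) (CkM oU h12 h21))) => x _;
    rewrite cImM.
Qed.

Lemma Ck_pmap V k (U : set V) g (f : V -> C2) : open U ->
  Ck k U (@R4_of_C2 R \o f) -> Ck k U (@R4_of_C2 R \o (pmap g \o f)).
Proof.
move=> oU Cf; apply/Ck_R4_of_C2 => //.
by split; exact: Ck_ev.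
Qed.

Lemma Ck_evaluable_R4 : Ck_evaluable R4.
Proof. by do 2 apply: Ck_evaluable_prod; exact: Ck_evaluable_R. Qed.

Lemma Ck_evaluable_R6 : Ck_evaluable ((R * R) * R4)%type.
Proof.
apply: Ck_evaluable_prod; last exact: Ck_evaluable_R4.
by apply: Ck_evaluable_prod; exact: Ck_evaluable_R.
Qed.

Lemma Ck_comp_R4 V W k (U : set V) (U' : set W) (q : V -> W) (f : W -> R4) :
  Ck_evaluable W -> open U -> open U' -> (forall x, U x -> U' (q x)) ->
  Ck k U q -> Ck k U' f -> Ck k U (f \o q).
Proof.
move=> eW oU oU' UU Cq Cf.
have C1 := Ck_fst oU' Cf; have C2 := Ck_snd oU' Cf.
have C11 := Ck_comp eW oU UU Cq (Ck_fst oU' C1).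
have C12 := Ck_comp eW oU UU Cq (Ck_snd oU' C1).
have C21 := Ck_comp eW oU UU Cq (Ck_fst oU' C2).
have C22 := Ck_comp eW oU UU Cq (Ck_snd oU' C2).
apply: (eq_Ck oU _ (Ck_pair oU (Ck_pair oU C11 C12) (Ck_pair oU C21 C22))).
by move=> x _ /=; case: (f (q x)) => [[? ?] [? ?]].
Qed.

(** A local extension h of f on U yields the local extension g o h o q on the open set q^-1(U). The
    outer map is polynomial, so it needs no extending. *)
Lemma smooth_on_comp V W (A : set W) (A' : set V) g (q : V -> W) (f : W -> C2) :
  Ck_evaluable W -> (forall k, Ck k setT q) -> (forall x, A' x -> A (q x)) ->
  smooth_on A (@R4_of_C2 R \o f) ->
  smooth_on A' (@R4_of_C2 R \o (pmap g \o (f \o q))).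
Proof.
move=> eW Cq AA sf x /AA /sf [U [h [oU Uqx Ch hf]]].
have oqU : open (q @^-1` U).
  by apply: open_comp => // y _; exact: (Cq 0%N).
exists (q @^-1` U), (@R4_of_C2 R \o (pmap g \o (@C2_of_R4 R \o (h \o q)))).
split=> //= [k|y Uy A'y].
  apply: Ck_pmap => //.
  rewrite (_ : _ \o _ = h \o q); last first.
    by apply/funext => y; rewrite /= C2_of_R4K.
  exact: (Ck_comp_R4 eW oqU oU (fun _ => id) (Ck_subset (@subsetT _ _) (Cq k)) (Ch k)).
by rewrite hf// ?R4_of_C2K//; exact: AA.
Qed.

Lemma Ck_R4_pmap k g :
  Ck k setT (fun a : R4 => @R4_of_C2 R (pmap g (@C2_of_R4 R a))).
Proof.
apply: Ck_pmap; first exact: openT.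
rewrite (_ : _ \o _ = id); first exact: Ck_id.
by apply/funext => a; rewrite /= C2_of_R4K.
Qed.

Lemma Ck_R2_aut1 V (f : V -> R * R) k (s : aut1 R) : Ck k setT f ->
  Ck k setT (fun x => R2_of_C (aut1_fun s (C_of_R2 (f x)))).
Proof.
move=> Cf; pose h (x : V) : C2 := (C_of_R2 (f x), 0).
have Ch : Ck k setT (@R4_of_C2 R \o h).
  apply/Ck_R4_of_C2; first exact: openT.
  split; split; [exact: Ck_fst openT Cf|exact: Ck_snd openT Cf|..];
    exact: Ck_cst.
have [C1 C2] := Ck_ev (aut1_poly s)%:P openT Ch.
have := Ck_pair openT C1 C2; congr Ck; apply/funext => x.
by rewrite !evC.
Qed.

Lemma aut1_continuous (s : aut1 R) : continuous (aut1_fun s).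
Proof.
move=> x; rewrite (_ : aut1_fun s = (fun c => aut1_deriv s * c + aut1_fun s 0)).
  have ? := is_diff_affine (aut1_deriv s) (aut1_fun s 0) x.
  by apply: differentiable_continuous; exact: ex_diff.
by apply/funext => c; exact: aut1_affine.
Qed.

End RealCoordinates.

(** * Conjugate polynomials: fibers, local triviality, bifurcation sets *)

Section Conjugacy.
Variable R : realType.
Local Notation C := (Cplx R).
Local Notation C2 := (C * C)%type.
Local Notation I01 := (`[0%R, 1%R]%classic : set R).

Definition conjugate (H H' : poly2 R) (psi : aut2 R) (sigma : aut1 R) :=
  forall z, ev H' z = aut1_fun sigma (ev H (aut2_fun (aut2_inv psi) z)).

(** The map underlying [aut2_inv (aut2_inv psi)] is that of [psi] by computation; the rewriting
    pattern lets unification see it. *)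
Lemma conjugate_sym H H' psi sigma : conjugate H H' psi sigma ->
  conjugate H' H (aut2_inv psi) (aut1_inv sigma).
Proof. by move=> hH z; rewrite hH aut1_funK [aut2_fun _ _]aut2_funK. Qed.

Lemma conjugate_ev H H' psi sigma z : conjugate H H' psi sigma ->
  ev H' (aut2_fun psi z) = aut1_fun sigma (ev H z).
Proof. by move=> hH; rewrite hH aut2_funK. Qed.

Lemma conjugate_ev_inv H H' psi sigma z : conjugate H H' psi sigma ->
  ev H (aut2_fun (aut2_inv psi) z) = aut1_fun (aut1_inv sigma) (ev H' z).
Proof. by move=> hH; rewrite hH aut1_funK. Qed.

Lemma fiber_conjugate H H' psi sigma c z : conjugate H H' psi sigma ->
  fiber H c z -> fiber H' (aut1_fun sigma c) (aut2_fun psi z).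
Proof. by move=> hH <-; rewrite /fiber /= (conjugate_ev _ hH). Qed.

Lemma locally_trivial_conjugate H H' psi sigma (B : set C) :
  conjugate H H' psi sigma -> locally_trivial H B ->
  locally_trivial H' (aut1_fun (aut1_inv sigma) @^-1` B).
Proof.
move=> hH ltB c' /= /ltB [U [phi [Phi [[oU Uc UB] h1 h2 s1 s2]]]].
pose s := aut1_fun sigma; pose t := aut1_fun (aut1_inv sigma).
pose f := aut2_fun psi; pose g := aut2_fun (aut2_inv psi).
have sK : cancel s t := @aut1_funK R sigma.
have tK : cancel t s := @aut1_invK R sigma.
have fK : cancel f g := @aut2_funK R psi.
have gK : cancel g f := @aut2_invK R psi.
have evg z : ev H (g z) = t (ev H' z) := conjugate_ev_inv z hH.
have evf z : ev H' (f z) = s (ev H z) := conjugate_ev z hH.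
(* The trivialization conjugated by psi, over sigma(U). Writing sigma(U) as a preimage under
   sigma^-1 makes openness a matter of continuity. *)
exists (t @^-1` U), (f \o phi \o g), (fun a => f (Phi (t a.1, g a.2))); split.
- split=> //; last by move=> b /UB.
  by apply: open_comp => // x _; exact: aut1_continuous.
- move=> z /=; rewrite -evg => /h1 [phig Phig]; split.
    by rewrite /fiber /= evf phig; exact: tK.
  by rewrite fK Phig gK.
- move=> b w /= Ub Fw; have Fgw : fiber H (t c') (g w).
    by rewrite /fiber /= evg Fw.
  by have [E1 E2] := h2 _ _ Ub Fgw; rewrite evf E1 fK E2 tK gK.
- have := @smooth_on_comp R _ _ _ [set a | (t @^-1` U) (ev H' (C2_of_R4 a))]
    (aut2_poly psi) _ _ (@Ck_evaluable_R4 R)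
    (fun k => @Ck_R4_pmap R k (aut2_ipoly psi)) _ s1.
  rewrite (_ : _ \o (_ \o _) = fun a => R4_of_C2 ((f \o phi \o g) (C2_of_R4 a))).
    by apply => a; rewrite /= -evg R4_of_C2K.
  by apply/funext => a; rewrite /= R4_of_C2K.
(* The change of variables sigma^-1 x psi^-1 in real coordinates, on base times fiber. *)
pose q (a : (R * R) * ((R * R) * (R * R))) :=
  (R2_of_C (t (C_of_R2 a.1)), R4_of_C2 (g (C2_of_R4 a.2))).
have Cq k : Ck k setT q.
  apply: Ck_pair; first exact: openT.
    by apply: Ck_R2_aut1; apply: Ck_fst; [exact: openT|exact: Ck_id].
  exact: (Ck_comp_R4 (@Ck_evaluable_R4 R) openT openT (fun _ _ => I)
    (Ck_snd openT (Ck_id k setT)) (Ck_R4_pmap k (aut2_ipoly psi))).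
have := @smooth_on_comp R _ _ _
    [set a | (t @^-1` U) (C_of_R2 a.1) /\ fiber H' c' (C2_of_R4 a.2)]
    (aut2_poly psi) q _ (@Ck_evaluable_R6 R) Cq _ s2.
rewrite (_ : _ \o (_ \o _) =
  fun a => R4_of_C2 (f (Phi (t (C_of_R2 a.1), g (C2_of_R4 a.2))))).
  apply=> a [Ua Fa] /=; rewrite R2_of_CK R4_of_C2K; split=> //.
  by rewrite /fiber /= evg Fa.
by apply/funext => a; rewrite /= R2_of_CK R4_of_C2K.
Qed.

(** The bifurcation set is the intersection of all admissible finite sets, and the preimage under
    sigma of one admissible for H' is admissible for H. *)
Lemma bifset_conjugate_inv H H' psi sigma c : conjugate H H' psi sigma ->
  bifset H (aut1_fun (aut1_inv sigma) c) -> bifset H' c.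
Proof.
move=> hH Bc B' [[finB' ltB'] B'0]; rewrite -(aut1_invK sigma c).
apply: (Bc (aut1_fun sigma @^-1` B')); split => //; split.
  rewrite (_ : _ @^-1` _ = aut1_fun (aut1_inv sigma) @` B').
    exact: finite_image.
  apply/seteqP; split=> [x /= B'x|_ [x B'x <-] /=].
    by exists (aut1_fun sigma x) => //; exact: aut1_funK.
  by rewrite aut1_invK.
exact: locally_trivial_conjugate (conjugate_sym hH) ltB'.
Qed.

Lemma bifset_conjugate H H' psi sigma c : conjugate H H' psi sigma ->
  bifset H' (aut1_fun sigma c) <-> bifset H c.
Proof.
move=> hH; split; first exact: bifset_conjugate_inv (conjugate_sym hH).
by rewrite -{1}(aut1_funK sigma c); exact: bifset_conjugate_inv.
Qed.

(** If an admissible finite set exists, the intersection is finite, hence compact; otherwise it is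
    an intersection over the empty family, that is, all of C. *)
Lemma bifset_closed (H : poly2 R) : closed (bifset H).
Proof.
have [[B [finB ltB]]|noB] :=
  pselect (exists B, finite_set B /\ locally_trivial H B).
  apply: compact_closed; first exact: norm_hausdorff.
  apply: finite_compact; apply: (sub_finite_set _ finB).
  by move=> x; apply; split; [|move=> ? []].
rewrite (_ : bifset H = setT) ?closedT//.
by apply/seteqP; split=> // c _ B [PB _]; case: noB; exists B.
Qed.

Lemma near_bifset (H : poly2 R) (c : C) : ~ bifset H c ->
  \forall z \near c, ~ bifset H z.
Proof.
move=> nBc; have oB := closed_openC (@bifset_closed H).
exact: (open_nbhs_nbhs (conj oB nBc)).
Qed.

End Conjugacy.

(** * Integrability of piecewise continuous functions *)

Section LineIntegral.
Variable R : realType.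
Local Notation C := (Cplx R).
Local Notation C2 := (C * C)%type.
Local Notation R4 := ((R * R) * (R * R))%type.
Local Notation I01 := (`[0%R, 1%R]%classic : set R).
Local Notation mu := (@lebesgue_measure R).

(** The extension of f by zero from A [|] B is the sum of those from A and from B minus A. *)
Lemma integrable_setU d (T : measurableType d) (nu : {measure set T -> \bar R})
    (A B : set T) (f : T -> \bar R) : measurable A -> measurable B ->
  nu.-integrable A f -> nu.-integrable B f -> nu.-integrable (A `|` B) f.
Proof.
move=> mA mB iA iB; have mBA := measurableD mB mA.
have /(integrable_mkcond f mA) iA' := iA.
have /(integrable_mkcond f mBA) iB' : nu.-integrable (B `\` A) f.
  by apply: integrableS iB => // x [].
apply/integrable_mkcond; first exact: measurableU.
apply: eq_integrable (integrableD measurableT iA' iB') => //.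
move=> x _; rewrite /patch /=; have [xA|xA] := pselect (A x).
  have nBA : ~ (B `\` A) x by case.
  by rewrite (memNset nBA) (mem_set xA) (mem_set (or_introl xA : (A `|` B) x)) adde0.
rewrite (memNset xA); have [xB|xB] := pselect (B x).
  rewrite (mem_set (conj xB xA : (B `\` A) x)).
  by rewrite (mem_set (or_intror xB : (A `|` B) x)) add0e.
have nBA : ~ (B `\` A) x by case.
have nAB : ~ (A `|` B) x by case.
by rewrite (memNset nBA) (memNset nAB) adde0.
Qed.

(** Agreement is asked on open intervals only, since a velocity has arbitrary values at break
    points; these points are null sets. *)
Lemma integrable_piecewise (h : R -> R) (n : nat) (s : nat -> R) :
  (forall i, (i < n)%N -> s i < s i.+1 /\ exists2 k : R -> R, continuous k &
     forall t, s i < t < s i.+1 -> h t = k t) ->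
  mu.-integrable `[s 0%N, s n]%classic (EFin \o h).
Proof.
move=> hs.
have ipt x : mu.-integrable [set x] (EFin \o h).
  apply/(@negligible_integrable _ _ _ mu _ [set x]) => //.
  - exact: measurable_fun_set1.
  - exact: lebesgue_measure_set1.
  - by rewrite setDv; exact: integrable_set0.
suff : forall i, (i <= n)%N -> s 0%N <= s i /\
    mu.-integrable `[s 0%N, s i]%classic (EFin \o h).
  by move=> /(_ n (leqnn n))[].
elim=> [_|i IH lt_in]; first by split=> //; rewrite set_itv1.
have [s0i IHi] := IH (ltnW lt_in); have [sii [k ck hk]] := hs i lt_in.
split; first exact: le_trans s0i (ltW sii).
rewrite (_ : `[s 0%N, s i.+1]%classic =
  `[s 0%N, s i]%classic `|` (`]s i, s i.+1[%classic `|` [set s i.+1])).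
  apply: integrable_setU => //; first exact: measurableU.
  apply: integrable_setU => //.
  have ik : mu.-integrable `[s i, s i.+1]%classic (EFin \o k).
    apply: continuous_compact_integrable; first exact: segment_compact.
    exact: continuous_subspaceT.
  have iok : mu.-integrable `]s i, s i.+1[%classic (EFin \o k).
    by apply: integrableS ik => //; apply: subset_itv; rewrite bnd_simp.
  apply: eq_integrable iok => // t.
  by rewrite inE /= in_itv /= => /hk ->.
apply/seteqP; split=> t /=; rewrite !in_itv /=.
  move=> /andP[s0t tsi]; have [tsi'|] := leP t (s i).
    by left; rewrite s0t.
  move=> sit; right; move: tsi; rewrite le_eqVlt => /orP[/eqP->|tsi].
    by right.
  by left; rewrite tsi.
move=> [/andP[-> /= tsi]|[/andP[sit tsi]|->]].
- exact: le_trans tsi (ltW sii).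
- by rewrite (ltW tsi) (le_trans s0i)// ltW.
- by rewrite lexx (le_trans s0i)// ltW.
Qed.

Lemma subdivision_cover (n : nat) (s : nat -> R) t :
  s 0%N <= t <= s n -> (forall i, (i <= n)%N -> t != s i) ->
  exists2 i, (i < n)%N & s i < t < s i.+1.
Proof.
elim: n => [/andP[s0t ts0] /(_ 0%N isT)|n IH /andP[s0t tsn] nt].
  by rewrite eq_le s0t ts0.
have [tsn'|sn't] := leP t (s n).
  have [|i lin sit] := IH _ (fun i lin => nt i (leqW lin)).
    by rewrite s0t.
  by exists i => //; exact: ltnW.
exists n => //; rewrite sn't /= lt_neqAle tsn andbT.
exact: nt.
Qed.

End LineIntegral.

(** * Velocities of curves and their images under polynomial maps *)

Section LineIntegralConjugacy.
Variable R : realType.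
Local Notation C := (Cplx R).
Local Notation C2 := (C * C)%type.
Local Notation I01 := (`[0%R, 1%R]%classic : set R).
Local Notation mu := (@lebesgue_measure R).

Lemma diff_cst_val (K : numFieldType) (V W : normedModType K) (a : W) (x v : V) :
  'd (fun=> a) x v = 0.
Proof. by rewrite [fun=> a]/(cst a) diff_cst. Qed.

Definition rdiff (f : R -> R) (t a : R) := differentiable f t /\ 'd f t 1 = a.

Lemma eq_rdiff (f g : R -> R) t a b :
  f =1 g -> a = b -> rdiff f t a -> rdiff g t b.
Proof. by move=> /funext -> ->. Qed.

Lemma rdiff_cst (c t : R) : rdiff (fun=> c) t 0.
Proof. by split; [exact: differentiable_cst|exact: diff_cst_val]. Qed.

Lemma rdiffD (f g : R -> R) t a b :
  rdiff f t a -> rdiff g t b -> rdiff (fun s => f s + g s) t (a + b).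
Proof. by move=> [df <-] [dg <-]; exact: diffD_val. Qed.

Lemma rdiffM (f g : R -> R) t a b :
  rdiff f t a -> rdiff g t b -> rdiff (fun s => f s * g s) t (f t * b + a * g t).
Proof. by move=> [df <-] [dg <-]; exact: diffM_val. Qed.

Lemma rdiff_derive1 (f : R -> R) t a : rdiff f t a -> derive1 f t = a.
Proof. by move=> [df <-]; exact: derive1E'. Qed.

Lemma Ck_rdiff k (f : R -> R) t : Ck k.+1 setT f -> rdiff f t (derive1 f t).
Proof.
move=> [df _]; split; first exact: df.
by apply: esym; apply: derive1E'; exact: df.
Qed.

Lemma Ck_derive1 k (f : R -> R) : Ck k.+1 setT f -> Ck k setT (derive1 f).
Proof.
move=> Cf; apply: (eq_Ck openT _ (Cf.2 1)) => t _.
exact: (Ck_rdiff t Cf).2.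
Qed.

(** C is used as a normed module over itself, so differentiation in a real parameter goes through
    real and imaginary parts. *)
Definition cdiff (h : R -> C) (t : R) (l : C) :=
  rdiff (fun s => complex.Re (h s)) t (complex.Re l) /\
  rdiff (fun s => complex.Im (h s)) t (complex.Im l).

Lemma cdiff_ev (g : R -> C2) t (v : C2) (p : poly2 R) :
  cdiff (fun s => (g s).1) t v.1 -> cdiff (fun s => (g s).2) t v.2 ->
  cdiff (fun s => ev p (g s)) t (form_of (dform p) (g t) v).
Proof.
move=> c1 c2.
apply: (@ev_derivation R R (fun h => cdiff h t) g t v _ _ _ c1 c2 p).
- by move=> c; split; exact: rdiff_cst.
- move=> h k l m [h1 h2] [k1 k2]; split.
    by apply: eq_rdiff (rdiffD h1 k1) => [s|]; rewrite cReD.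
  by apply: eq_rdiff (rdiffD h2 k2) => [s|]; rewrite cImD.
- move=> h k l m [h1 h2] [k1 k2]; split.
    apply: eq_rdiff (rdiffD (rdiffM h1 k1)
      (rdiffM (rdiff_cst (-1) t) (rdiffM h2 k2))) => [s|].
      by rewrite cReM mulN1r.
    by rewrite cReD !cReM; ring.
  apply: eq_rdiff (rdiffD (rdiffM h1 k2) (rdiffM h2 k1)) => [s|].
    by rewrite cImM.
  by rewrite cImD !cImM; ring.
Qed.

Lemma cdiff_velocity (g : R -> C2) t (v : C2) :
  cdiff (fun s => (g s).1) t v.1 -> cdiff (fun s => (g s).2) t v.2 ->
  velocity g t = v.
Proof.
move=> [d1 d2] [d3 d4]; rewrite /velocity (rdiff_derive1 d1) (rdiff_derive1 d2).
rewrite (rdiff_derive1 d3) (rdiff_derive1 d4).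
by case: v {d1 d2 d3 d4} => [[a b] [c d]].
Qed.

Lemma velocity_pmap (g : R -> C2) t (q : poly2 R * poly2 R) :
  cdiff (fun s => (g s).1) t (velocity g t).1 ->
  cdiff (fun s => (g s).2) t (velocity g t).2 ->
  velocity (pmap q \o g) t = dmap q (g t) (velocity g t).
Proof. by move=> d1 d2; apply: cdiff_velocity; apply: cdiff_ev. Qed.

Lemma Ck_velocity (f : R -> C2) t : Ck 1 setT (@R4_of_C2 R \o f) ->
  cdiff (fun s => (f s).1) t (velocity f t).1 /\
  cdiff (fun s => (f s).2) t (velocity f t).2.
Proof.
move=> /(Ck_R4_of_C2 _ _ openT)[[C1 C2] [C3 C4]].
split; split; [exact: (Ck_rdiff t C1)|exact: (Ck_rdiff t C2)|..].
  exact: (Ck_rdiff t C3).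
exact: (Ck_rdiff t C4).
Qed.

Lemma velocity_near (f g : R -> C2) t : {near t, f =1 g} ->
  velocity f t = velocity g t.
Proof.
move=> fg; rewrite /velocity !derive1E.
by congr ((_ +i* _)%C, (_ +i* _)%C); apply: near_eq_derive;
  apply: filterS fg => s ->.
Qed.

(** Supplies, on each C^1 piece, the continuous function required by [integrable_piecewise]. *)
Lemma velocity_continuous (f : R -> C2) (w : pform R) :
  Ck 1 setT (@R4_of_C2 R \o f) ->
  continuous (fun t => complex.Re (form_of w (f t) (velocity f t))) /\
  continuous (fun t => complex.Im (form_of w (f t) (velocity f t))).
Proof.
move=> Cf; have Cv : Ck 0 setT (@R4_of_C2 R \o velocity f).
  have [[C1 C2] [C3 C4]] := (Ck_R4_of_C2 1 f openT).1 Cf.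
  apply/Ck_R4_of_C2; first exact: openT.
  split; split; [exact: (Ck_derive1 C1)|exact: (Ck_derive1 C2)|..].
    exact: (Ck_derive1 C3).
  exact: (Ck_derive1 C4).
have [[v11 v12] [v21 v22]] := (Ck_R4_of_C2 0 (velocity f) openT).1 Cv.
have [a1 b1] := Ck_ev w.1 openT (CkW Cf).
have [a2 b2] := Ck_ev w.2 openT (CkW Cf).
have N (h : R -> R) : Ck 0 setT h -> Ck 0 setT (fun x => -1 * h x).
  by move=> Ch; exact: (CkM openT (Ck_cst 0 setT (-1 : R)) Ch).
have CR : Ck 0 setT (fun t => complex.Re (form_of w (f t) (velocity f t))).
  apply: (eq_Ck openT _ (CkD openT
    (CkD openT (CkM openT a1 v11) (N _ (CkM openT b1 v12)))
    (CkD openT (CkM openT a2 v21) (N _ (CkM openT b2 v22))))) => s _.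
  by rewrite !mulN1r /form_of cReD !cReM.
have CI : Ck 0 setT (fun t => complex.Im (form_of w (f t) (velocity f t))).
  apply: (eq_Ck openT _ (CkD openT
    (CkD openT (CkM openT a1 v12) (CkM openT b1 v11))
    (CkD openT (CkM openT a2 v22) (CkM openT b2 v21)))) => s _.
  by rewrite /form_of cImD !cImM.
by split=> t; [exact: CR|exact: CI].
Qed.

End LineIntegralConjugacy.

(** * Change of variables in line integrals *)

Section LineIntegralChange.
Variable R : realType.
Local Notation C := (Cplx R).
Local Notation C2 := (C * C)%type.
Local Notation I01 := (`[0%R, 1%R]%classic : set R).
Local Notation mu := (@lebesgue_measure R).

Lemma piecewise_C1_pmap (q : poly2 R * poly2 R) (g : R -> C2) :
  piecewise_C1 g -> piecewise_C1 (pmap q \o g).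
Proof.
move=> [n [s [s0 sn hs]]]; exists n, s; split=> // i lin.
have [sii [f Cf gf]] := hs i lin; split=> //.
exists (pmap q \o f); first exact: (Ck_pmap q openT Cf).
by move=> t st; rewrite /= gf.
Qed.

Lemma near_rdiff (f g : R -> R) t a : {near t, f =1 g} ->
  rdiff f t a -> rdiff g t a.
Proof.
move=> fg [df <-]; have [dg E] := near_eq_differentiable fg df.
by split; [exact: dg|exact: E].
Qed.

Lemma near_cdiff (h k : R -> C) t l : {near t, h =1 k} ->
  cdiff h t l -> cdiff k t l.
Proof.
move=> hk [d1 d2]; split; [apply: near_rdiff d1|apply: near_rdiff d2];
  by apply: filterS hk => s ->.
Qed.

Lemma piecewise_C1_regular (g : R -> C2) : piecewise_C1 g ->
  (exists2 S : set R, finite_set S & forall t, (I01 `\` S) t ->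
     cdiff (fun s => (g s).1) t (velocity g t).1 /\
     cdiff (fun s => (g s).2) t (velocity g t).2) /\
  forall w, mu.-integrable I01
      (EFin \o (fun t => complex.Re (form_of w (g t) (velocity g t)))) /\
    mu.-integrable I01
      (EFin \o (fun t => complex.Im (form_of w (g t) (velocity g t)))).
Proof.
move=> [n [s [s0 sn hs]]].
have near_f i t (f : R -> C2) : s i < t < s i.+1 ->
    (forall t, s i <= t <= s i.+1 -> g t = f t) -> {near t, f =1 g}.
  move=> st gf; have : nbhs t `]s i, s i.+1[%classic.
    by apply: open_nbhs_nbhs; split; [exact: itv_open|rewrite /= in_itv].
  apply: filterS => y; rewrite /= in_itv /= => /andP[/ltW y1 /ltW y2].
  by rewrite gf// y1.
split; last first.
  move=> w; rewrite -s0 -sn; split; apply: integrable_piecewise => i lin;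
    have [sii [f Cf gf]] := hs i lin; split=> //;
    have [cR cI] := velocity_continuous w Cf.
    eexists; first exact: cR.
    move=> t st; have nf := near_f i t f st gf.
    by rewrite (nbhs_singleton nf) (velocity_near nf).
  eexists; first exact: cI.
  move=> t st; have nf := near_f i t f st gf.
  by rewrite (nbhs_singleton nf) (velocity_near nf).
(* The exceptional set is that of the n + 1 subdivision points, both ends included. *)
exists (s @` `I_n.+1); first by apply: finite_image; exact: finite_II.
move=> t [/=]; rewrite in_itv /= -s0 -sn => t01 nS.
have [i lin st] : exists2 i, (i < n)%N & s i < t < s i.+1.
  apply: subdivision_cover => // i lin; apply/eqP => tsi.
  by apply: nS; exists i.
have [sii [f Cf gf]] := hs i lin; have nf := near_f i t f st gf.
have [c1 c2] := Ck_velocity t Cf.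
rewrite (velocity_near nf) in c1 c2; split.
  by apply: near_cdiff c1; apply: filterS nf => y ->.
by apply: near_cdiff c2; apply: filterS nf => y ->.
Qed.

Lemma Rintegral_finite_setD (S : set R) (h : R -> R) : finite_set S ->
  mu.-integrable I01 (EFin \o h) ->
  \int[mu]_(t in I01) h t = \int[mu]_(t in I01 `\` S) h t.
Proof.
move=> finS ih; rewrite /Rintegral; congr fine.
have S0 : mu S = 0%E.
  exact: countable_lebesgue_measure0 (finite_set_countable finS).
have mS : measurable (S : set (measurableTypeR R)).
  exact: countable_measurable (finite_set_countable finS).
apply: (@negligible_integral _ _ _ mu) => //.
Qed.

Lemma Rintegral_linear (D : set R) (f g : R -> R) (a b : R) :
  measurable (D : set (measurableTypeR R)) ->
  mu.-integrable D (EFin \o f) -> mu.-integrable D (EFin \o g) ->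
  \int[mu]_(t in D) (a * f t + b * g t) =
  a * \int[mu]_(t in D) f t + b * \int[mu]_(t in D) g t.
Proof.
move=> mD intf intg.
have iZ (r : R) (h : R -> R) : mu.-integrable D (EFin \o h) ->
    mu.-integrable D (EFin \o (fun t => r * h t)).
  move=> ih; have irh := integrableZl mD r ih.
  by apply: eq_integrable irh => // t _; rewrite /= EFinM.
rewrite RintegralD //; [|exact: iZ|exact: iZ].
by rewrite !RintegralZl.
Qed.

Lemma line_integral_aut2 (psi : aut2 R) (a : C) (w w' : pform R) (g : R -> C2) :
  (forall z v, form_of w' z v = a * push_form psi (form_of w) z v) ->
  piecewise_C1 g ->
  line_integral w' (aut2_fun psi \o g) = a * line_integral w g.
Proof.
move=> hw Cg; have [[S1 finS1 reg1] int1] := piecewise_C1_regular Cg.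
have [_ int2] :=
  piecewise_C1_regular (piecewise_C1_pmap (aut2_poly psi) Cg).
have [intR intI] := int1 w; have [intR' intI'] := int2 w'.
pose F t := form_of w (g t) (velocity g t).
pose F' t := form_of w' (aut2_fun psi (g t)) (velocity (aut2_fun psi \o g) t).
(* At a regular t the velocity of psi o g is the image of that of g under the differential of psi,
   which the differential of psi^-1 in [push_form] undoes: the integrands are proportional
   pointwise. *)
have FE t : (I01 `\` S1) t -> F' t = a * F t.
  move=> /reg1[c1 c2]; rewrite /F' hw /push_form /pull_form.
  rewrite (velocity_pmap (aut2_poly psi) c1 c2) (dmapK _ _ (aut2_polyK psi)).
  by rewrite [pmap _ _](aut2_polyK psi).
have mI : measurable (I01 `\` S1 : set (measurableTypeR R)).
  apply: measurableD; first exact: measurable_itv.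
  exact: countable_measurable (finite_set_countable finS1).
have sub (h : R -> R) : mu.-integrable I01 (EFin \o h) ->
    mu.-integrable (I01 `\` S1) (EFin \o h).
  by apply: integrableS => // t [].
rewrite /line_integral -/(F _) -/(F' _).
rewrite (Rintegral_finite_setD finS1 intR) (Rintegral_finite_setD finS1 intI).
rewrite (Rintegral_finite_setD finS1 intR') (Rintegral_finite_setD finS1 intI').
(* As a is complex, each part of the new integral combines both parts of the old one. *)
have -> : \int[mu]_(t in I01 `\` S1) complex.Re (F' t) =
    complex.Re a * \int[mu]_(t in I01 `\` S1) complex.Re (F t) +
    - complex.Im a * \int[mu]_(t in I01 `\` S1) complex.Im (F t).
  rewrite -(Rintegral_linear _ _ mI (sub _ intR) (sub _ intI)).
  by apply: eq_Rintegral => t; rewrite inE => /FE ->; rewrite cReM mulNr.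
have -> : \int[mu]_(t in I01 `\` S1) complex.Im (F' t) =
    complex.Re a * \int[mu]_(t in I01 `\` S1) complex.Im (F t) +
    complex.Im a * \int[mu]_(t in I01 `\` S1) complex.Re (F t).
  rewrite -(Rintegral_linear _ _ mI (sub _ intI) (sub _ intR)).
  by apply: eq_Rintegral => t; rewrite inE => /FE ->; rewrite cImM.
rewrite mulNr; by case: a {hw FE} => [a1 a2].
Qed.

End LineIntegralChange.

(** * Transport of loops, cycles and Abelian integrals *)

Section Transport.
Variable R : realType.
Local Notation C := (Cplx R).
Local Notation C2 := (C * C)%type.
Local Notation I01 := (`[0%R, 1%R]%classic : set R).

Lemma within_continuous_post (T U V : topologicalType) (A : set T)
    (f : T -> U) (g : U -> V) :
  continuous g -> {within A, continuous f} -> {within A, continuous (g \o f)}.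
Proof.
by move=> cg cf x; apply: (@continuous_comp (subspace A)); [exact: cf|exact: cg].
Qed.

Lemma within_continuous_pre (T U V : topologicalType) (A : set T) (B : set U)
    (q : T -> U) (f : U -> V) :
  continuous q -> (forall x, A x -> B (q x)) ->
  {within B, continuous f} -> {within A, continuous (f \o q)}.
Proof.
move=> cq AB /subspace_continuousP cf; apply/subspace_continuousP => x Ax.
apply: cvg_trans (cf _ (AB _ Ax)) => P /= fP.
(* A neighbourhood within B is a neighbourhood for the implication from B; the restatements expose
   this form. *)
have H : nbhs (q x) (fun y => B y -> P (f y)) := fP.
have Hq : nbhs x (fun y => B (q y) -> P (f (q y))) := cq x _ H.
change (nbhs x (fun y => A y -> P (f (q y)))).
exact: (filterS (fun y yP Ay => yP (AB y Ay)) Hq).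
Qed.

Lemma is_loop_map (T U : topologicalType) (A : set T) (B : set U) (f : T -> U)
    (g : R -> T) : continuous f -> (forall x, A x -> B (f x)) ->
  is_loop A g -> is_loop B (f \o g).
Proof.
move=> cf AB [cg g01 gA]; split; first exact: within_continuous_post.
  by rewrite /= g01.
by move=> t /gA /AB.
Qed.

Lemma loop_homotopic_map (T U : topologicalType) (A : set T) (B : set U)
    (f : T -> U) (g h : R -> T) : continuous f -> (forall x, A x -> B (f x)) ->
  loop_homotopic A g h -> loop_homotopic B (f \o g) (f \o h).
Proof.
move=> cf AB [k [ck kA k01 kgh]]; exists (f \o k); split.
- exact: within_continuous_post.
- by move=> s t Is It; apply: AB; exact: kA.
- by move=> s Is; rewrite /= k01.
- by move=> t It; rewrite /= !(kgh t It).1 !(kgh t It).2.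
Qed.

Lemma contractible_map (T U : topologicalType) (A : set T) (B : set U)
    (f : T -> U) (g : R -> T) : continuous f -> (forall x, A x -> B (f x)) ->
  contractible A g -> contractible B (f \o g).
Proof. by move=> cf AB [z /(loop_homotopic_map cf AB) h]; exists (f z). Qed.

Lemma aut2_continuous (psi : aut2 R) : continuous (aut2_fun psi).
Proof. exact: pmap_continuous. Qed.

Lemma smooth_loop_conjugate H H' psi sigma c (g : R -> C2) :
  @conjugate R H H' psi sigma -> smooth_loop (fiber H c) g ->
  smooth_loop (fiber H' (aut1_fun sigma c)) (aut2_fun psi \o g).
Proof.
move=> hH [lg Cg]; split; last exact: piecewise_C1_pmap.
apply: is_loop_map lg; first exact: aut2_continuous.
by move=> x; exact: fiber_conjugate.
Qed.

Lemma contractible_conjugate H H' psi sigma c (g : R -> C2) :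
  @conjugate R H H' psi sigma -> contractible (fiber H c) g ->
  contractible (fiber H' (aut1_fun sigma c)) (aut2_fun psi \o g).
Proof.
move=> hH; apply: contractible_map; first exact: aut2_continuous.
by move=> x; exact: fiber_conjugate.
Qed.

Lemma aut2_comp_funK (T : Type) (psi : aut2 R) (g : T -> C2) :
  aut2_fun (aut2_inv psi) \o (aut2_fun psi \o g) = g.
Proof. by apply/funext => t /=; rewrite aut2_funK. Qed.

Lemma is_cycle_conjugate H H' psi sigma c (g : R -> C2) :
  @conjugate R H H' psi sigma -> is_cycle H c g ->
  is_cycle H' (aut1_fun sigma c) (aut2_fun psi \o g).
Proof.
move=> hH [sg ng]; split; first exact: smooth_loop_conjugate hH sg.
move=> /(contractible_conjugate (conjugate_sym hH)).
by rewrite aut1_funK aut2_comp_funK.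
Qed.

Lemma near_aut1 (s : aut1 R) (c : C) (P : C -> Prop) :
  (\forall z \near c, P z) ->
  \forall z \near aut1_fun s c, P (aut1_fun (aut1_inv s) z).
Proof.
move=> nP; have := @aut1_continuous R (aut1_inv s) (aut1_fun s c).
by rewrite /continuous_at aut1_funK => /(_ _ nP).
Qed.

Lemma transported_conjugate H H' psi sigma c0 (gam : C -> R -> C2) :
  @conjugate R H H' psi sigma -> transported H c0 gam ->
  transported H' (aut1_fun sigma c0)
    (fun c => aut2_fun psi \o gam (aut1_fun (aut1_inv sigma) c)).
Proof.
move=> hH [N [nN NB cN gN]].
exists (aut1_fun (aut1_inv sigma) @^-1` N); split.
- exact: near_aut1 nN.
- move=> c /NB nB; rewrite -(aut1_invK sigma c).
  by move=> /(bifset_conjugate _ hH).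
- pose q (a : C * R) := (aut1_fun (aut1_inv sigma) a.1, a.2).
  have cq : continuous q.
    move=> x; have c1 : {for x, continuous (aut1_fun (aut1_inv sigma) \o @fst C R)}.
      by apply: continuous_comp; [exact: cvg_fst|exact: aut1_continuous].
    have c2 : {for x, continuous (@snd C R)} by exact: cvg_snd.
    exact: (cvg_pair c1 c2).
  have := within_continuous_pre cq
    (A := (aut1_fun (aut1_inv sigma) @^-1` N) `*` I01) _ cN.
  move=> /(_ (fun _ => id)).
  exact: within_continuous_post (@aut2_continuous psi).
- by move=> c /gN /(smooth_loop_conjugate hH); rewrite aut1_invK.
Qed.

Lemma abelian_integral_conjugate H psi sigma (w w' : pform R)
    (gam : C -> R -> C2) c :
  (forall z v, form_of w' z v =
     aut1_deriv sigma * push_form psi (form_of w) z v) ->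
  smooth_loop (fiber H c) (gam c) ->
  abelian_integral w'
    (fun c => aut2_fun psi \o gam (aut1_fun (aut1_inv sigma) c))
    (aut1_fun sigma c) = aut1_deriv sigma * abelian_integral w gam c.
Proof.
move=> hw [_ Cg]; rewrite /abelian_integral aut1_funK.
exact: line_integral_aut2.
Qed.

Lemma push_formK (psi : aut2 R) (eta : Defs.form R) z v :
  push_form psi eta (aut2_fun psi z) (dmap (aut2_poly psi) z v) = eta z v.
Proof.
rewrite /push_form /pull_form (dmapK _ _ (aut2_polyK psi)).
by rewrite [pmap _ _](aut2_polyK psi).
Qed.

Lemma push_form_inv (psi : aut2 R) (a : C) (eta eta' : Defs.form R) : a != 0 ->
  (forall z v, eta' z v = a * push_form psi eta z v) ->
  forall z v, eta z v = a^-1 * push_form (aut2_inv psi) eta' z v.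
Proof.
by move=> a0 hw z v; rewrite {1}/push_form /pull_form hw mulKf// push_formK.
Qed.

End Transport.

(** * Zeros, multiplicities and analytic continuation under an affine change *)

Section Zeros.
Variable R : realType.
Local Notation C := (Cplx R).
Local Notation I01 := (`[0%R, 1%R]%classic : set R).
Implicit Types (s : aut1 R) (f g h : C -> C).

Lemma card_eq_inverse (T U : Type) (A : set T) (B : set U)
    (f : T -> U) (g : U -> T) :
  (forall x, A x -> B (f x)) -> (forall y, B y -> A (g y)) ->
  (forall x, A x -> g (f x) = x) -> (forall y, B y -> f (g y) = y) ->
  A #= B.
Proof.
move=> AB BA fK gK; rewrite card_eq_sym (_ : B = f @` A).
  apply: inj_card_eq => x y /set_mem Ax /set_mem Ay E.
  by rewrite -(fK x Ax) -(fK y Ay) E.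
by apply/seteqP; split=> [y By|_ [x Ax <-]]; [exists (g y); auto|exact: AB].
Qed.

Lemma is_diff_differentiable (K : numFieldType) (V W : normedModType K)
    (f df : V -> W) x : is_diff x f df -> differentiable f x.
Proof. by move=> ?; exact: ex_diff. Qed.

Lemma holomorphic_at_affine s (a b : C) h c : holomorphic_at h c ->
  holomorphic_at (fun z => a * h (aut1_fun (aut1_inv s) z) + b) (aut1_fun s c).
Proof.
move=> /(near_aut1 s); apply: filterS => y dh.
pose t := aut1_inv s.
have d1 := is_diff_differentiable
  (is_diff_affine (aut1_deriv t) (aut1_fun t 0) y).
have E : (fun c => aut1_deriv t * c + aut1_fun t 0) = aut1_fun t.
  by apply/funext => z; rewrite -aut1_affine.
rewrite E in d1.
have d2 := is_diff_differentiable (is_diff_affine a b (h (aut1_fun t y))).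
exact: (differentiable_comp (differentiable_comp d1 dh) d2).
Qed.

Lemma holomorphic_at_scale s (a : C) h c : holomorphic_at h c ->
  holomorphic_at (fun z => a * h (aut1_fun (aut1_inv s) z)) (aut1_fun s c).
Proof.
move=> /(@holomorphic_at_affine s a 0); congr holomorphic_at.
by apply/funext => z; rewrite addr0.
Qed.

Lemma vanishes_aut1 s (a : C) f f' c k :
  (\forall z \near aut1_fun s c, f' z = a * f (aut1_fun (aut1_inv s) z)) ->
  vanishes f c k -> vanishes f' (aut1_fun s c) k.
Proof.
(* As t(z) - c is t' times z - s(c), its k-th power leaves the factor t'^k, absorbed in the cofactor
   together with a. *)
move=> ff' [h hh fh]; pose t := aut1_inv s; pose b := a * aut1_deriv t ^+ k.
exists (fun z => b * h (aut1_fun t z)); first exact: holomorphic_at_scale.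
move: (near_aut1 s fh); apply: filterS2 ff' => z -> ->.
have -> : aut1_fun t z - c = aut1_deriv t * (z - aut1_fun s c).
  rewrite -[in LHS](aut1_funK s c) (aut1_affine t z) (aut1_affine t (aut1_fun s c)).
  by ring.
by rewrite exprMn /b; ring.
Qed.

Lemma is_branch_aut1 s (a : C) (B B' : set C) f f' c0 c g :
  (forall z, B' (aut1_fun s z) -> B z) ->
  (\forall z \near aut1_fun s c0, f' z = a * f (aut1_fun (aut1_inv s) z)) ->
  is_branch B f c0 c g ->
  is_branch B' f' (aut1_fun s c0) (aut1_fun s c)
    (fun z => a * g (aut1_fun (aut1_inv s) z)).
Proof.
move=> BB ff' [lam [F [[clam lamB holF conF] lam0 lam1 F0 F1]]].
exists (aut1_fun s \o lam), (fun t z => a * F t (aut1_fun (aut1_inv s) z)).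
split; [split|by rewrite /= lam0|by rewrite /= lam1|..].
- exact: within_continuous_post (@aut1_continuous R s) clam.
- by move=> t It /BB; exact: lamB.
- by move=> t It; exact: holomorphic_at_scale (holF t It).
- move=> t It; have := conF t It; apply: filterS => u FE Iu.
  by have := near_aut1 s (FE Iu); apply: filterS => z ->.
- by have := near_aut1 s F0; apply: filterS2 ff' => z -> ->.
- by have := near_aut1 s F1; apply: filterS => z ->.
Qed.

Lemma near_aut1_inv s (a : C) f f' c : a != 0 ->
  (\forall z \near aut1_fun s c, f' z = a * f (aut1_fun (aut1_inv s) z)) ->
  \forall z \near c, f z = a^-1 * f' (aut1_fun s z).
Proof.
move=> a0 /(near_aut1 (aut1_inv s)); rewrite aut1_funK; apply: filterS => z ->.
by rewrite [aut1_fun (aut1_inv s) _]aut1_funK mulKf.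
Qed.

Lemma is_branch_aut1_iff s (a : C) (B B' : set C) f f' c0 c g : a != 0 ->
  (forall z, B' (aut1_fun s z) <-> B z) ->
  (\forall z \near aut1_fun s c0, f' z = a * f (aut1_fun (aut1_inv s) z)) ->
  is_branch B f c0 c (fun z => a^-1 * g (aut1_fun s z)) <->
  is_branch B' f' (aut1_fun s c0) (aut1_fun s c) g.
Proof.
move=> a0 BB ff'; split=> [|br].
  move=> /(is_branch_aut1 (fun z => (BB z).1) ff').
  congr is_branch; apply/funext => z.
  by rewrite aut1_invK mulVKf.
rewrite -(aut1_funK s c0) -(aut1_funK s c).
apply: (is_branch_aut1 (s := aut1_inv s) _ _ br).
  by move=> z /BB; rewrite aut1_invK.
rewrite aut1_funK; exact: near_aut1_inv ff'.
Qed.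

Lemma zeros_aut1 s (a : C) (B B' : set C) f f' : a != 0 ->
  (forall z, B' (aut1_fun s z) <-> B z) ->
  (forall c, ~ B c ->
    \forall z \near aut1_fun s c, f' z = a * f (aut1_fun (aut1_inv s) z)) ->
  zeros B f #= zeros B' f'.
Proof.
move=> a0 BB ff'.
apply: (@card_eq_inverse _ _ _ _ (fun x => (aut1_fun s x.1, x.2))
  (fun x => (aut1_fun (aut1_inv s) x.1, x.2))).
- move=> [c k] [/= nB vf]; split=> /=; first by move=> /BB.
  exact: vanishes_aut1 (ff' c nB) vf.
- move=> [c k] [/= nB vf]; split=> /=.
    by move=> /BB; rewrite aut1_invK.
  have nB' : ~ B (aut1_fun (aut1_inv s) c) by move=> /BB; rewrite aut1_invK.
  exact: (vanishes_aut1 (s := aut1_inv s) (near_aut1_inv a0 (ff' _ nB')) vf).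
- by move=> [c k] _ /=; rewrite aut1_funK.
- by move=> [c k] _ /=; rewrite aut1_invK.
Qed.

(** On the germ of g at c the second component is the germ of z |-> a * g (s^-1 z) at s(c). Taking a
    preimage defines it on every set of functions, with an evident inverse. *)
Definition push_zero s (a : C) (x : C * set (C -> C) * nat) :
    C * set (C -> C) * nat :=
  (aut1_fun s x.1.1, [set h | x.1.2 (fun z => a^-1 * h (aut1_fun s z))], x.2).

Lemma push_zeroK s (a : C) : a != 0 ->
  cancel (push_zero s a) (push_zero (aut1_inv s) a^-1).
Proof.
move=> a0 [[c G] k]; rewrite /push_zero /= aut1_funK; congr (_, _, _).
apply/seteqP; split=> h /=; congr G; apply/funext => z;
  by rewrite aut1_funK invrK mulKf.
Qed.

Lemma branch_zeros_push s (a : C) (B B' : set C) f f' c0 x : a != 0 ->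
  (forall z, B' (aut1_fun s z) -> B z) ->
  (\forall z \near aut1_fun s c0, f' z = a * f (aut1_fun (aut1_inv s) z)) ->
  branch_zeros B f c0 x -> branch_zeros B' f' (aut1_fun s c0) (push_zero s a x).
Proof.
move: x => [[c G] k] a0 BB ff' [g [/= bg -> vg]].
exists (fun z => a * g (aut1_fun (aut1_inv s) z)); split.
- exact: is_branch_aut1 ff' bg.
- apply/seteqP; split=> h /=; rewrite /germ /= => hg.
    have := near_aut1 s hg; apply: filterS => z.
    by rewrite aut1_invK => <-; rewrite mulVKf.
  have := near_aut1 (aut1_inv s) hg; rewrite aut1_funK; apply: filterS => z.
  by rewrite [aut1_fun (aut1_inv s) _]aut1_funK => ->; rewrite mulKf.
- have E : \forall z \near aut1_fun s c,
      a * g (aut1_fun (aut1_inv s) z) = a * g (aut1_fun (aut1_inv s) z).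
    by apply: filterE => z; reflexivity.
  exact: vanishes_aut1 E vg.
Qed.

Lemma branch_zeros_aut1 s (a : C) (B B' : set C) f f' c0 : a != 0 ->
  (forall z, B' (aut1_fun s z) <-> B z) ->
  (\forall z \near aut1_fun s c0, f' z = a * f (aut1_fun (aut1_inv s) z)) ->
  branch_zeros B f c0 #= branch_zeros B' f' (aut1_fun s c0).
Proof.
move=> a0 BB ff'; have a0' : a^-1 != 0 by rewrite invr_eq0.
apply: (@card_eq_inverse _ _ _ _ (push_zero s a)
  (push_zero (aut1_inv s) a^-1)).
- by move=> x; apply: branch_zeros_push ff' => // z /BB.
- have ff : \forall z \near aut1_fun (aut1_inv s) (aut1_fun s c0),
      f z = a^-1 * f' (aut1_fun (aut1_inv (aut1_inv s)) z).
    by rewrite aut1_funK; exact: near_aut1_inv ff'.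
  move=> y; rewrite -{2}(aut1_funK s c0); apply: branch_zeros_push ff => //.
  by move=> z /BB; rewrite aut1_invK.
- by move=> x _; exact: push_zeroK.
- move=> y _; have := push_zeroK (aut1_inv s) a0' y.
  by rewrite invrK.
Qed.

End Zeros.

(** * Singular chains under a homeomorphism of C^2 *)

Section Homology.
Variable R : realType.
Local Notation C := (Cplx R).
Local Notation C2 := (C * C)%type.
Local Notation I01 := (`[0%R, 1%R]%classic : set R).
Implicit Types (x y : chain1 R) (n : int).

Lemma chain_map_id (f g : C2 -> C2) x : cancel f g ->
  chain_map g (chain_map f x) = x.
Proof.
move=> fK; rewrite /chain_map -map_comp -[RHS]map_id; apply: eq_map => -[n s] /=.
by congr pair; apply/funext => t /=; rewrite fK.
Qed.

Lemma chain_map_scale (f : C2 -> C2) n x :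
  chain_map f (chain_scale n x) = chain_scale n (chain_map f x).
Proof. by rewrite /chain_map /chain_scale -!map_comp. Qed.

Lemma chain_map_big (f : C2 -> C2) (r : nat) (F : 'I_r -> chain1 R) :
  chain_map f (\big[cat/[::]]_(i < r) F i) =
  \big[cat/[::]]_(i < r) chain_map f (F i).
Proof. by elim/big_ind2: _ => // _ x _ y <- <-; rewrite /chain_map map_cat. Qed.

Lemma boundary2_map (f : C2 -> C2) (d : seq (int * (R * R -> C2))) :
  boundary2 [seq (p.1, f \o p.2) | p <- d] = chain_map f (boundary2 d).
Proof. by elim: d => //= p d IH; rewrite /boundary2 /= -/(boundary2 _) IH. Qed.

Variables (f g : C2 -> C2).
Hypotheses (fK : cancel f g) (gK : cancel g f) (cf : continuous f).

(** Bijectivity of f matters: no two distinct simplices merge, so coefficients are merely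
    relabelled. *)
Lemma coef_chain_map x s : coef (chain_map f x) s = coef x (g \o s).
Proof.
rewrite /coef big_map; apply: eq_bigl => p; apply: asbool_equiv_eq.
by split=> ps t It /=; [rewrite -ps//= fK|rewrite ps//= gK].
Qed.

Lemma cycle1_map (A B : set C2) x : (forall z, A z -> B (f z)) ->
  cycle1 A x -> cycle1 B (chain_map f x).
Proof.
move=> AB [xA x0]; split=> [_ /mapP[p px ->] /=|z].
  have [cp Ap] := xA p px; split; first exact: (within_continuous_post cf cp).
  by move=> t /Ap /AB.
rewrite big_map; apply: etrans (x0 (g z)); apply: eq_bigr => p _ /=.
have E (w : C2) : (f w == z) = (w == g z).
  by apply/eqP/eqP => [<-|->]; rewrite ?fK ?gK.
by rewrite !E.
Qed.

Lemma homologous_map (A B : set C2) x y : (forall z, A z -> B (f z)) ->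
  homologous A x y -> homologous B (chain_map f x) (chain_map f y).
Proof.
move=> AB [d [dA dxy]]; exists [seq (p.1, f \o p.2) | p <- d]; split.
  move=> _ /mapP[p pd ->] /=; have [cp Ap] := dA p pd.
  split; first exact: (within_continuous_post cf cp).
  by move=> a /Ap /AB.
by move=> s; rewrite boundary2_map !coef_chain_map.
Qed.

End Homology.

(** * Rank of the first homology and canonical generators *)

Section CanonicalGenerators.
Variable R : realType.
Local Notation C := (Cplx R).
Local Notation C2 := (C * C)%type.

Lemma H1_rank_map (A B : set C2) (f g : C2 -> C2) r :
  cancel f g -> cancel g f -> continuous f -> continuous g ->
  (forall z, A z -> B (f z)) -> (forall z, B z -> A (g z)) ->
  H1_rank A r -> H1_rank B r.
Proof.
move=> fK gK cf cg AB BA [z [zA zx]].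
exists (fun i => chain_map f (z i)); split=> [i|x Bx].
  exact: (cycle1_map fK gK cf AB (zA i)).
have sumE (n : {ffun 'I_r -> int}) :
    chain_map f (\big[cat/[::]]_(i < r) chain_scale (n i) (z i)) =
    \big[cat/[::]]_(i < r) chain_scale (n i) (chain_map f (z i)).
  by rewrite chain_map_big; apply: eq_bigr => i _; rewrite chain_map_scale.
(* The coordinates of x are those of its pull-back by g; a second decomposition of x pulls back as
   well, whence uniqueness. *)
have [n [hn un]] := zx _ (cycle1_map gK fK cg BA Bx).
exists n; split=> [|m hm].
  have := homologous_map fK gK cf AB hn.
  by rewrite sumE (chain_map_id _ gK).
apply: un; have := homologous_map gK fK cg BA hm.
by rewrite -sumE (chain_map_id _ fK).
Qed.

Lemma H1_rank_conjugate H H' psi sigma c r : @conjugate R H H' psi sigma ->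
  H1_rank (fiber H c) r -> H1_rank (fiber H' (aut1_fun sigma c)) r.
Proof.
move=> hH; apply: (H1_rank_map (@aut2_funK R psi) (@aut2_invK R psi)).
- exact: aut2_continuous.
- exact: aut2_continuous.
- by move=> z; exact: fiber_conjugate.
- move=> z /(fiber_conjugate (conjugate_sym hH)).
  by rewrite aut1_funK.
Qed.

Lemma canonical_generators_conjugate H H' psi sigma r
    (gam : 'I_r -> C -> R -> C2) : @conjugate R H H' psi sigma ->
  canonical_generators H gam ->
  canonical_generators H'
    (fun i c => aut2_fun psi \o gam i (aut1_fun (aut1_inv sigma) c)).
Proof.
move=> hH [K [G [f [s [rho [nf Ks pun rkH genH]]]]]].
have [f' [f'E f'invE]] := aut2_comp f (aut2_inv psi).
have [s' s'E] := aut1_comp s (aut1_inv sigma).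
have nB c : ~ bifset H' c -> ~ bifset H (aut1_fun (aut1_inv sigma) c).
  by move=> nBc /(bifset_conjugate _ hH); rewrite aut1_invK.
(* The normal form and its punctures stay the same; only the normalizing automorphisms change, to f
   o psi^-1 and s o sigma^-1. The new generators then have exactly the old images in the punctured
   lines. *)
exists K, G, f', s', rho; split=> //.
- move=> z; rewrite Ks s'E f'invE /=.
  rewrite [aut2_fun (aut2_inv (aut2_inv psi)) _]/(aut2_fun psi _).
  by rewrite (conjugate_ev _ hH) aut1_funK.
- move=> c /nB /rkH /(H1_rank_conjugate hH).
  by rewrite aut1_invK.
move=> i c /nB /(genH i) [sl enc]; split.
  by have := smooth_loop_conjugate hH sl; rewrite aut1_invK.
have -> : (fun t => ev G (aut2_fun f' ((aut2_fun psi \o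
      gam i (aut1_fun (aut1_inv sigma) c)) t))) =
    (fun t => ev G (aut2_fun f (gam i (aut1_fun (aut1_inv sigma) c) t))).
  by apply/funext => t; rewrite f'E /= aut2_funK.
by rewrite s'E.
Qed.

End CanonicalGenerators.

(** * Leaves, return maps and limit cycles of conjugate forms *)

Section LimitCycles.
Variable R : realType.
Local Notation C := (Cplx R).
Local Notation C2 := (C * C)%type.
Local Notation I01 := (`[0%R, 1%R]%classic : set R).

Definition form_conjugate (psi : aut2 R) (a : C) (Om Om' : Defs.form R) :=
  a != 0 /\ forall z v, Om' z v = a * push_form psi Om z v.

Lemma form_conjugate_sym psi a Om Om' : form_conjugate psi a Om Om' ->
  form_conjugate (aut2_inv psi) a^-1 Om' Om.
Proof.
by move=> [a0 hO]; split; [rewrite invr_eq0|exact: push_form_inv hO].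
Qed.

Lemma form_conjugateE psi a Om Om' z v : form_conjugate psi a Om Om' ->
  Om' (aut2_fun psi z) (dmap (aut2_poly psi) z v) = a * Om z v.
Proof. by move=> [_ hO]; rewrite hO push_formK. Qed.

Lemma first_integral_conjugate psi a Om Om' p F :
  form_conjugate psi a Om Om' -> first_integral Om p F ->
  first_integral Om' (aut2_fun psi p) (F \o aut2_fun (aut2_inv psi)).
Proof.
move=> hO [[v Ov] nF]; have a0 := hO.1; split.
  exists (dmap (aut2_poly psi) p v).
  by rewrite (form_conjugateE _ _ hO) mulf_neq0.
have nF' : \forall z \near aut2_fun psi p,
    differentiable F (aut2_fun (aut2_inv psi) z) /\
    exists2 g : C, g != 0 & forall v, 'd F (aut2_fun (aut2_inv psi) z) v =
      g * Om (aut2_fun (aut2_inv psi) z) v.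
  have := @aut2_continuous R (aut2_inv psi) (aut2_fun psi p).
  by rewrite /continuous_at aut2_funK => /(_ _ nF).
move: nF'; apply: filterS => z [dF [g g0 gE]].
have di := is_diff_pmap (aut2_ipoly psi) z.
have d1 := is_diff_differentiable di.
split; first exact: (differentiable_comp d1 dF).
(* The differential of F o psi^-1 is g times the pushed form, which is a^-1 times [Om']. *)
exists (g / a) => [|u]; first by rewrite mulf_neq0 ?invr_eq0.
have E := congr1 (fun h : C2 -> C => h u) (diff_comp d1 dF).
have Ei := congr1 (fun h : C2 -> C2 => h u) (@diff_val _ _ _ _ _ _ _ di).
have OE : g / a * Om' z u =
    g * Om (aut2_fun (aut2_inv psi) z) (dmap (aut2_ipoly psi) z u).
  by rewrite hO.2 mulrA divfK.
rewrite OE -gE -Ei; exact: E.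
Qed.

Lemma leafwise_conjugate psi a Om Om' (T : topologicalType) (D : set T)
    (f : T -> C2) : form_conjugate psi a Om Om' ->
  leafwise Om D f -> leafwise Om' D (aut2_fun psi \o f).
Proof.
move=> hO [cf lf]; split.
  exact: (within_continuous_post (@aut2_continuous _ psi) cf).
move=> x Dx; have [F FI nF] := lf x Dx.
exists (F \o aut2_fun (aut2_inv psi)); first exact: first_integral_conjugate hO FI.
by move: nF; apply: filterS => y yF Dy /=; rewrite !aut2_funK yF.
Qed.

Lemma leaf_homotopic_conjugate psi a Om Om' (g h : R -> C2) :
  form_conjugate psi a Om Om' -> leaf_homotopic Om g h ->
  leaf_homotopic Om' (aut2_fun psi \o g) (aut2_fun psi \o h).
Proof.
move=> hO [k [lk k01 kgh]]; exists (aut2_fun psi \o k); split.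
- exact: leafwise_conjugate hO lk.
- by move=> s Is; rewrite /= k01.
- by move=> t It; rewrite /= !(kgh t It).1 !(kgh t It).2.
Qed.

Lemma complex_cycle_conjugate psi a Om Om' (g : R -> C2) :
  form_conjugate psi a Om Om' -> complex_cycle Om g ->
  complex_cycle Om' (aut2_fun psi \o g).
Proof.
move=> hO [[lg g01] ng]; split.
  by split; [exact: leafwise_conjugate hO lg|rewrite /= g01].
move=> [z hz]; apply: ng; exists (aut2_fun (aut2_inv psi) z).
have := leaf_homotopic_conjugate (form_conjugate_sym hO) hz.
by rewrite aut2_comp_funK.
Qed.

(** With psi o tau as transversal the coordinate z is unchanged, so the germ P itself is kept, and
    with it the property of differing from the identity. *)
Lemma return_map_conjugate psi a Om Om' (g : R -> C2) tau P :
  form_conjugate psi a Om Om' -> return_map Om g tau P ->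
  return_map Om' (aut2_fun psi \o g) (aut2_fun psi \o tau) P.
Proof.
move=> hO [[htau tau0 Otau] cP P0 [N [lift [nN cl l0 lN]]]].
have dpsi z := is_diff_pmap (aut2_poly psi) z.
split=> //.
  split; last 1 first.
  - have E := congr1 (fun h : C -> C2 => h 1)
      (diff_comp (nbhs_singleton htau) (is_diff_differentiable (dpsi (tau 0)))).
    have Ei := congr1 (fun h : C2 -> C2 => h ('d tau 0 1))
      (@diff_val _ _ _ _ _ _ _ (dpsi (tau 0))).
    have -> : 'd (aut2_fun psi \o tau) 0 1 =
        dmap (aut2_poly psi) (tau 0) ('d tau 0 1) := etrans E Ei.
    by rewrite /= (form_conjugateE _ _ hO) mulf_neq0// hO.1.
  - move: htau; apply: filterS => z dz.
    exact: (differentiable_comp dz (is_diff_differentiable (dpsi (tau z)))).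
  - by rewrite /= tau0.
exists N, (fun z => aut2_fun psi \o lift z); split; first exact: nN.
- exact: (within_continuous_post (@aut2_continuous _ psi) cl).
- by move=> t It; rewrite /= l0.
move=> z /lN[ll lz0 lz1]; split; first exact: leafwise_conjugate hO ll.
  by rewrite /= lz0.
by rewrite /= lz1.
Qed.

Lemma limit_cycle_conjugate psi a Om Om' (g : R -> C2) :
  form_conjugate psi a Om Om' -> limit_cycle Om g ->
  limit_cycle Om' (aut2_fun psi \o g).
Proof.
move=> hO [cg [tau [P [rP nP]]]]; split; first exact: complex_cycle_conjugate hO cg.
exists (aut2_fun psi \o tau), P; split; last exact: nP.
exact: return_map_conjugate hO rP.
Qed.

(** The same factor sigma' multiplies dH and the perturbation, so the parameter e is not
    rescaled. *)
Lemma perturbed_conjugate H H' psi sigma (w w' : pform R) (e : C) :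
  @conjugate R H H' psi sigma ->
  (forall z v, form_of w' z v =
     aut1_deriv sigma * push_form psi (form_of w) z v) ->
  form_conjugate psi (aut1_deriv sigma) (perturbed H w e) (perturbed H' w' e).
Proof.
move=> hH hw; split=> [|z v]; first exact: aut1_deriv_neq0.
rewrite /perturbed (form_of_dform_aut z v hH) hw /push_form /pull_form.
by ring.
Qed.

Lemma generated_family_conjugate H H' psi sigma (w w' : pform R) c g Gam :
  @conjugate R H H' psi sigma ->
  (forall z v, form_of w' z v =
     aut1_deriv sigma * push_form psi (form_of w) z v) ->
  generated_family H w c g Gam ->
  generated_family H' w' (aut1_fun sigma c) (aut2_fun psi \o g)
    (fun e => aut2_fun psi \o Gam e).
Proof.
move=> hH hw [D [nD cG hG lG]]; exists D; split; first exact: nD.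
- exact: (within_continuous_post (@aut2_continuous _ psi) cG).
- apply: loop_homotopic_map hG; first exact: aut2_continuous.
  by move=> x; exact: fiber_conjugate.
- move=> e De e0.
  exact: (limit_cycle_conjugate (perturbed_conjugate e hH hw) (lG e De e0)).
Qed.

Definition push_families (psi : aut2 R) (X : set (C -> R -> C2)) :=
  [set Gam : C -> R -> C2 | X (fun e => aut2_fun (aut2_inv psi) \o Gam e)].

Lemma push_familiesK psi : cancel (push_families psi) (push_families (aut2_inv psi)).
Proof.
move=> X; apply/seteqP; split=> Gam; rewrite /push_families /=; congr X;
  by apply/funext => e; rewrite aut2_comp_funK.
Qed.

Lemma generated_limit_cycles_push H H' psi sigma (w w' : pform R) r
    (gam : 'I_r -> C -> R -> C2) X :
  @conjugate R H H' psi sigma ->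
  (forall z v, form_of w' z v =
     aut1_deriv sigma * push_form psi (form_of w) z v) ->
  generated_limit_cycles H w gam X ->
  generated_limit_cycles H' w'
    (fun i c => aut2_fun psi \o gam i (aut1_fun (aut1_inv sigma) c))
    (push_families psi X).
Proof.
move=> hH hw [i [c [Gam [nB gG ->]]]].
exists i, (aut1_fun sigma c), (fun e => aut2_fun psi \o Gam e); split.
- by move=> /(bifset_conjugate _ hH).
- by rewrite aut1_funK; exact: generated_family_conjugate hw gG.
(* Leaf homotopies are carried both ways for each e, so the pushed class is exactly the class of the
   pushed family. *)
apply/seteqP; split=> Gam' /=; apply: filterS => e.
  move=> /(leaf_homotopic_conjugate (perturbed_conjugate e hH hw)).
  by rewrite [aut2_fun psi \o _](@aut2_comp_funK R _ (aut2_inv psi)).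
move=> /(leaf_homotopic_conjugate (form_conjugate_sym (perturbed_conjugate e hH hw))).
by rewrite aut2_comp_funK.
Qed.

End LimitCycles.

Theorem corollary5 (R : realType) (H H' : poly2 R)
    (psi : aut2 R) (sigma : aut1 R) (omega theta : pform R)
    (hH : forall z, ev H' z = aut1_fun sigma (ev H (aut2_fun (aut2_inv psi) z)))
    (htheta : forall z v, form_of theta z v =
       aut1_deriv sigma * push_form psi (form_of omega) z v) :
  [/\
    forall (e : Cplx R) z v,
      aut1_deriv sigma * push_form psi (perturbed H omega e) z v =
      perturbed H' theta e z v,
    forall (c0 : Cplx R) (gam : Cplx R -> R -> Cplx R * Cplx R),
      ~ bifset H c0 -> is_cycle H c0 (gam c0) -> transported H c0 gam ->
      let delta c := aut2_fun psi \o gam (aut1_fun (aut1_inv sigma) c) in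
      let I := abelian_integral omega gam in
      let J := abelian_integral theta delta in
      [/\ [/\ ~ bifset H' (aut1_fun sigma c0),
              is_cycle H' (aut1_fun sigma c0) (delta (aut1_fun sigma c0)) &
              transported H' (aut1_fun sigma c0) delta],
          \forall c \near c0,
            I c = (aut1_deriv sigma)^-1 * J (aut1_fun sigma c),
          forall (c : Cplx R) (g : Cplx R -> Cplx R),
            is_branch (bifset H) I c0 c
              (fun z => (aut1_deriv sigma)^-1 * g (aut1_fun sigma z)) <->
            is_branch (bifset H') J (aut1_fun sigma c0) (aut1_fun sigma c) g &
          branch_zeros (bifset H) I c0 #=
          branch_zeros (bifset H') J (aut1_fun sigma c0)] &
    forall (r : nat) (gam : 'I_r -> Cplx R -> R -> Cplx R * Cplx R),
      primitive H -> trivial_monodromy H -> canonical_generators H gam ->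
      let delta i c := aut2_fun psi \o gam i (aut1_fun (aut1_inv sigma) c) in
      [/\ canonical_generators H' delta,
          forall i, zeros (bifset H) (abelian_integral omega (gam i)) #=
                    zeros (bifset H') (abelian_integral theta (delta i)) &
          non_conservative H omega gam ->
          generated_limit_cycles H omega gam #=
          generated_limit_cycles H' theta delta]].
Proof.
have hH' := conjugate_sym hH.
have a0 := aut1_deriv_neq0 sigma.
have BB c : bifset H' (aut1_fun sigma c) <-> bifset H c := bifset_conjugate c hH.
have hinv z v : form_of omega z v =
    aut1_deriv (aut1_inv sigma) * push_form (aut2_inv psi) (form_of theta) z v.
  by rewrite aut1_deriv_inv; apply: (push_form_inv a0 htheta).
split.
- by move=> e z v; rewrite (perturbed_conjugate e hH htheta).2.
- move=> c0 gam nB cyc tr delta I J.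
  have IJ : \forall c \near c0, J (aut1_fun sigma c) = aut1_deriv sigma * I c.
    have [N [nN _ _ gN]] := tr; move: nN; apply: filterS => c /gN sg.
    exact: abelian_integral_conjugate htheta sg.
  have JI : \forall c \near aut1_fun sigma c0,
      J c = aut1_deriv sigma * I (aut1_fun (aut1_inv sigma) c).
    by have := near_aut1 sigma IJ; apply: filterS => c; rewrite aut1_invK.
  split.
  + split; first by move=> /BB.
      have := is_cycle_conjugate hH cyc.
      by rewrite /delta aut1_funK.
    exact: transported_conjugate.
  + exact: (near_aut1_inv a0 JI).
  + by move=> c g; apply: is_branch_aut1_iff.
  + exact: branch_zeros_aut1 a0 BB JI.
move=> r gam _ _ gens delta; split.
- exact: canonical_generators_conjugate.
- move=> i; apply: (zeros_aut1 a0 BB) => c nB.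
  have [K [G [f [s [rho [_ _ _ _ genH]]]]]] := gens.
  (* Multiplicity at c concerns a neighbourhood; generic values form an open set, so the generators
     are smooth loops at all z near c. *)
  have IJ : \forall z \near c, abelian_integral theta (delta i) (aut1_fun sigma z) =
      aut1_deriv sigma * abelian_integral omega (gam i) z.
    move: (near_bifset nB); apply: filterS => z nBz.
    exact: (abelian_integral_conjugate htheta (genH i z nBz).1).
  by have := near_aut1 sigma IJ; apply: filterS => z; rewrite aut1_invK.
move=> _; apply: (@card_eq_inverse _ _ _ _ (push_families psi)
  (push_families (aut2_inv psi))).
- by move=> X; exact: generated_limit_cycles_push hH htheta.
(* Pushing [delta] by psi^-1 and sigma^-1 gives back [gam]. *)
- move=> X /(generated_limit_cycles_push hH' hinv).
  congr (generated_limit_cycles H omega _ _).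
  apply/funext => i; apply/funext => c; rewrite /delta.
  by rewrite [aut1_fun _ _]aut1_funK aut2_comp_funK.
- by move=> X _; exact: push_familiesK.
- by move=> X _; exact: (@push_familiesK R (aut2_inv psi)).
Qed.
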